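(* Let $\Omega\subsetneq\mathbb{R}^n$ be open, such that $-\Delta d\ge0$ in $\Omega$ in the sense of distributions, and such that $R:=\sup_{x\in\Omega}d(x)<\infty$. Then for all $u\in C_c^\infty(\Omega)$ and all $s>1$, $$\int_\Omega\frac{|\nabla u|}{d^{s-1}}dx\ \ge\ (s-1)\int_\Omega\frac{|u|}{d^s}dx+\frac{1}{R^{s-1}}\int_\Omega|\nabla u|\,dx.$$
   Context: $d(x):=\operatorname{dist}(x,\mathbb{R}^n\setminus\Omega)$. *)

(* Defs.v *)
From HB Require Import structures.
From mathcomp Require Import all_boot all_order all_algebra.
From mathcomp Require Import all_classical all_reals all_analysis.
Set Implicit Arguments. Unset Strict Implicit. Unset Printing Implicit Defensive.
Import Order.TTheory GRing.Theory Num.Theory.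
Import numFieldNormedType.Exports.
Local Open Scope classical_set_scope.
Local Open Scope ring_scope.

Section Defs.
Variable R : realType.

(* Euclidean norm on R^n = 'rV[R]_n (the library's norm on 'rV is the sup
   norm, so we define the Euclidean one explicitly). *)
Definition enorm (n : nat) (v : 'rV[R]_n) : R :=
  Num.sqrt (\sum_(i < n) (v ord0 i) ^+ 2).

Definition dist_compl (n : nat) (Omega : set 'rV[R]_n) (x : 'rV[R]_n) : R :=
  inf [set enorm (x - y) | y in ~` Omega].

Definition basis_vec (n : nat) (i : 'I_n) : 'rV[R]_n :=
  \row_(j < n) (j == i)%:R.

Definition partial (n : nat) (i : 'I_n) (f : 'rV[R]_n -> R) : 'rV[R]_n -> R :=
  fun x => 'D_(basis_vec i) f x.

Definition gradient (n : nat) (f : 'rV[R]_n -> R) (x : 'rV[R]_n) : 'rV[R]_n :=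
  \row_(i < n) partial i f x.

Definition laplacian (n : nat) (f : 'rV[R]_n -> R) : 'rV[R]_n -> R :=
  fun x => \sum_(i < n) partial i (partial i f) x.

Fixpoint iter_partial (n : nat) (l : seq 'I_n) (f : 'rV[R]_n -> R)
  : 'rV[R]_n -> R :=
  if l is i :: l' then partial i (iter_partial l' f) else f.

(* C^infinity: all iterated partial derivatives are (Frechet) differentiable
   everywhere (hence all partial derivatives of all orders exist and are
   continuous). *)
Definition smooth (n : nat) (f : 'rV[R]_n -> R) : Prop :=
  forall (l : seq 'I_n) (x : 'rV[R]_n), differentiable (iter_partial l f) x.

Definition test_fun (n : nat) (Omega : set 'rV[R]_n) (f : 'rV[R]_n -> R)
  : Prop :=
  [/\ smooth f, compact (closure [set x | f x != 0])
    & closure [set x | f x != 0] `<=` Omega].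

Definition cons_row (n : nat) (t : R) (v : 'rV[R]_n) : 'rV[R]_n.+1 :=
  \row_(i < n.+1) (if unlift ord0 i is Some j then v ord0 j else t).

(* Integral over R^n (iterated one-dimensional Lebesgue integrals).  All
   integrands used below are continuous with compact support, for which this
   agrees with the n-dimensional Lebesgue integral (Fubini). *)
Fixpoint integral_Rn (n : nat) : ('rV[R]_n -> R) -> R :=
  match n with
  | 0 => fun f => f 0
  | m.+1 => fun f =>
      Rintegral lebesgue_measure setT
        (fun t : R => integral_Rn (fun v : 'rV[R]_m => f (cons_row t v)))
  end.

Definition integral_over (n : nat) (Omega : set 'rV[R]_n)
  (f : 'rV[R]_n -> R) : R :=
  integral_Rn (fun x => if `[< Omega x >] then f x else 0).

Definition neg_laplacian_nonneg_distr (n : nat) (Omega : set 'rV[R]_n)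
  (g : 'rV[R]_n -> R) : Prop :=
  forall phi : 'rV[R]_n -> R, test_fun Omega phi ->
    (forall x, 0 <= phi x) ->
    0 <= - integral_over Omega (fun x => g x * laplacian phi x).

End Defs.

(* Main.v *)
Require Import Defs.
From HB Require Import structures.
From mathcomp Require Import all_boot all_order all_algebra.
From mathcomp Require Import all_classical all_reals all_analysis.
From mathcomp Require Import ring lra.
Set Implicit Arguments. Unset Strict Implicit. Unset Printing Implicit Defensive.
Import Order.TTheory GRing.Theory Num.Theory.
Import numFieldNormedType.Exports.
Local Open Scope classical_set_scope.
Local Open Scope ring_scope.

(* Formally, one tests [- Delta d >= 0] against [psi = |u| (d^(1-s) - R^(1-s)) >= 0]
   and uses [|grad d| = 1].  Finite differences replace the almost everywhere
   gradient of [d], so that neither Rademacher's theorem nor mollification of [d] is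
   needed.  Let [D_i(x) = 2 d(x) - d(x + r e_i) - d(x - r e_i)].

   - If [y] is an (almost) nearest point of the complement and [e = (x - y) / |x - y|],
     then [d(x + z) - d(x) <= e.z + O(|z|^2)].  Applied to [z = r e_i] and
     [z = - r e_i] this gives [|d(x + r e_i) - d(x) - r e.e_i| <= D_i(x) + O(r^2)]:
     the vector of differences of [d] is [r] times a unit vector, up to an error
     controlled by the second differences.  In particular [D_i >= - O(r^2)].
   - Summing by parts against a Lipschitz cutoff, [D_i + O(r^2)] has integral
     [O(r^2)] on compact sets.  So all error terms [r D_i] integrate to [O(r^3)].
   - Taylor expansion of the test function turns the hypothesis into
     [sum_i int psi D_i >= - O(r^3)] for smooth [psi >= 0]; by the previous point
     the measures [r^-2 (D_i + O(r^2)) dx] are bounded, whence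
     [sum_i int psi D_i >= - o(r^2)] for continuous [psi >= 0], by uniform
     approximation with finite combinations of translates of a smooth bump.

   Summing by parts, expanding [psi(x + r e_i) - psi(x)], dividing by [r^2] and letting
   [r] tend to [0] gives the inequality. *)

(** * Continuous functions with compact support *)

Section CompactSupport.
Context {R : realType}.

(** Compact support is encoded as vanishing off a ball of the sup norm, a form that passes at once
    to sums, translates and slices. *)
Definition cc (n : nat) (f : 'rV[R]_n -> R) : Prop :=
  continuous f /\ exists M, forall x, M < `|x| -> f x = 0.

Lemma eps_continuous (V : normedModType R) (f : V -> R) :
  (forall x e, 0 < e -> exists2 d, 0 < d &
    forall y, `|x - y| < d -> `|f x - f y| < e) -> continuous f.
Proof.
move=> fe x; apply/cvgrPdist_lt => e /(fe x)[d d0 Hd].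
by apply/nbhs_ballP; exists d => //= y; rewrite -ball_normE; exact: Hd.
Qed.

Lemma continuous_funB (n : nat) (f g : 'rV[R]_n -> R) :
  continuous f -> continuous g -> continuous (fun x : 'rV[R]_n => f x - g x).
Proof. by move=> cf cg x; apply: (@continuousB R R^o _ f g); [exact: cf|exact: cg]. Qed.

Lemma continuous_funM (n : nat) (f g : 'rV[R]_n -> R) :
  continuous f -> continuous g -> continuous (fun x : 'rV[R]_n => f x * g x).
Proof. by move=> cf cg x; apply: (@continuousM R _ f g); [exact: cf|exact: cg]. Qed.

Lemma continuous_fun_cst (n : nat) (c : R) : continuous (fun _ : 'rV[R]_n => c).
Proof. by move=> x; exact: cst_continuous. Qed.

Lemma rV_coord_le (n : nat) (x : 'rV[R]_n) (i : 'I_n) : `|x ord0 i| <= `|x|.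
Proof.
rewrite [leRHS]mx_normrE.
exact: (le_bigmax _ (fun ij : 'I_1 * 'I_n => `|x ij.1 ij.2|) (ord0, i)).
Qed.

Lemma rV_norm_le (n : nat) (x : 'rV[R]_n) (C : R) :
  0 <= C -> (forall i, `|x ord0 i| <= C) -> `|x| <= C.
Proof.
move=> C0 xC; rewrite [leLHS]mx_normrE; apply/bigmax_leP; split=> // -[a i] _ /=.
by rewrite ord1.
Qed.

Lemma ball_rV_compact (n : nat) (M : R) : compact [set x : 'rV[R]_n | `|x| <= M].
Proof.
apply: bounded_closed_compact.
  exists M; split; first exact: num_real.
  by move=> N MN x /= xM; rewrite (le_trans xM)// ltW.
apply: (@closed_comp _ _ (fun x : 'rV[R]_n => `|x|) [set t | t <= M]).
  by move=> x _; exact: norm_continuous.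
exact: closed_le.
Qed.

(** Compactness of the ball of radius [M + 1] gives a modulus that is uniform on it. If [x] lies off
    that ball and [y] is less than 1 away, then [f] vanishes at both points. *)
Lemma cc_unif (n : nat) (f : 'rV[R]_n -> R) : cc f ->
  forall e, 0 < e -> exists2 d, 0 < d &
    forall x y, `|x - y| < d -> `|f x - f y| < e.
Proof.
move=> [cf [M fM]] e e0.
have cK := @ball_rV_compact n (M + 1).
move/compact_near_coveringP : (cK).
move=> /(_ _ (nbhs (0 : 'rV[R]_n)) (fun z x => `|f x - f (x + z)| < e) _) H.
have {H} : \forall z \near (0 : 'rV[R]_n), [set x | `|x| <= M + 1] `<=`
    (fun x => `|f x - f (x + z)| < e).
  apply: H => x _.
  have e20 : 0 < e / 2 by rewrite divr_gt0.
  have H1 : \forall x' \near x, `|f x - f x'| < e / 2.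
    by have /cvgrPdist_lt := cf x; apply.
  have H3 : \forall x' \near x & z \near (0 : 'rV[R]_n), `|f x - f (x' + z)| < e / 2.
    have /(_ (fun y => `|f x - f y| < e / 2)) := @add_continuous _ (x, 0 : 'rV[R]_n).
    by rewrite /= addr0; exact.
  case: H3 => -[P Q] /= [nP nQ] PQ.
  exists ([set x' | `|f x - f x'| < e / 2] `&` P, Q); first by split=> //; exact: filterI.
  move=> [x' z] /= [[h1 Px'] Qz].
  have h2 : `|f x - f (x' + z)| < e / 2 by exact: (PQ (x', z)).
  rewrite (_ : f x' - f (x' + z) = (f x - f (x' + z)) - (f x - f x')); last by ring.
  by rewrite (le_lt_trans (ler_normB _ _))// (splitr e) ltrD.
move/nbhs_ballP => [d /= d0 Hd].
exists (Num.min d 1); first by rewrite lt_min d0 ltr01.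
move=> x y; rewrite lt_min => /andP[xd x1].
have [xM|Mx] := leP `|x| (M + 1).
  have := Hd (y - x) _ x xM; rewrite (addrC x) subrK; apply.
  by rewrite -ball_normE /= sub0r opprB.
have -> : f x = 0 by apply: fM; rewrite (lt_trans _ Mx)// ltrDl.
have -> : f y = 0.
  apply: fM; have := lerB_dist x (x - y); rewrite opprB (addrC x (y - x)) subrK => h.
  by lra.
by rewrite subrr normr0.
Qed.

Lemma cc_bounded (n : nat) (f : 'rV[R]_n -> R) : cc f ->
  exists2 C, 0 <= C & forall x, `|f x| <= C.
Proof.
move=> [cf [M fM]].
have : compact (f @` [set x | `|x| <= M]).
  apply: continuous_compact (@ball_rV_compact n M).
  exact: continuous_subspaceT.
move/compact_bounded => /ex_strict_bound_gt0 [C C0 HC].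
exists C; first exact: ltW.
move=> x; have [xM|Mx] := leP `|x| M; last by rewrite fM// normr0 ltW.
by apply: ltW; apply: HC; exists x.
Qed.

Lemma cc_sub (n : nat) (f g : 'rV[R]_n -> R) :
  cc f -> continuous g -> (forall x, f x = 0 -> g x = 0) -> cc g.
Proof.
by move=> [_ [M fM]] cg fg; split=> //; exists M => x /fM /fg.
Qed.

Lemma ccD (n : nat) (f g : 'rV[R]_n -> R) :
  cc f -> cc g -> cc (fun x => f x + g x).
Proof.
move=> [cf [M fM]] [cg [N gN]]; split.
  by move=> x; apply: continuousD; [exact: cf|exact: cg].
exists (Num.max M N) => x; rewrite gt_max => /andP[Mx Nx].
by rewrite fM// gN// addr0.
Qed.

Lemma ccMl (n : nat) (f g : 'rV[R]_n -> R) :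
  continuous f -> cc g -> cc (fun x => f x * g x).
Proof.
move=> cf [cg [N gN]]; split.
  by move=> x; apply: continuousM; [exact: cf|exact: cg].
by exists N => x Nx; rewrite gN// mulr0.
Qed.

Lemma ccMr (n : nat) (f g : 'rV[R]_n -> R) :
  cc f -> continuous g -> cc (fun x => f x * g x).
Proof.
move=> cf cg; rewrite (_ : (fun x => _) = (fun x => g x * f x)); first exact: ccMl.
by apply/funext => x; rewrite mulrC.
Qed.

Lemma ccZ (n : nat) (a : R) (f : 'rV[R]_n -> R) : cc f -> cc (fun x => a * f x).
Proof. by move=> cf; apply: ccMl => // x; exact: cst_continuous. Qed.

Lemma ccB (n : nat) (f g : 'rV[R]_n -> R) :
  cc f -> cc g -> cc (fun x => f x - g x).
Proof.
move=> cf /(ccZ (-1)) cg; rewrite (_ : (fun x => _) = (fun x => f x + -1 * g x)).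
  exact: ccD cf cg.
by apply/funext => x; rewrite mulN1r.
Qed.

Lemma cc0 (n : nat) : cc (fun _ : 'rV[R]_n => 0).
Proof. by split; [move=> x; exact: cst_continuous|exists 0]. Qed.

Lemma cc_sum (n m : nat) (f : 'I_m -> 'rV[R]_n -> R) :
  (forall i, cc (f i)) -> cc (fun x => \sum_i f i x).
Proof.
elim: m f => [|m IH] f cf.
  by rewrite (_ : (fun x => _) = (fun=> 0)); [exact: cc0|apply/funext => x; rewrite big_ord0].
rewrite (_ : (fun x => _) = (fun x => f ord0 x + \sum_i f (lift ord0 i) x)).
  exact: ccD (cf _) (IH _ (fun i => cf _)).
by apply/funext => x; rewrite big_ord_recl.
Qed.

Lemma cc_norm (n : nat) (f : 'rV[R]_n -> R) : cc f -> cc (fun x => `|f x|).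
Proof.
move=> cf; apply: (cc_sub cf) => [x|x ->]; last by rewrite normr0.
by apply: continuous_comp; [exact: cf.1|exact: norm_continuous].
Qed.

Lemma cc_family_bounded (n m : nat) (f : 'I_m -> 'rV[R]_n -> R) :
  (forall i, cc (f i)) -> exists2 C, 0 <= C & forall i x, `|f i x| <= C.
Proof.
move=> cf; have [C C0 HC] := cc_bounded (cc_sum (fun i => cc_norm (cf i))).
exists C => // i x; apply: le_trans (le_trans (ler_norm _) (HC x)).
by rewrite (bigD1 i)//= lerDl sumr_ge0.
Qed.

Lemma continuous_shiftr (n : nat) (z : 'rV[R]_n) (f : 'rV[R]_n -> R) :
  continuous f -> continuous (fun x : 'rV[R]_n => f (x + z)).
Proof.
move=> cf x; apply: continuous_comp; last exact: cf.
by apply: continuousD => //; exact: cst_continuous.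
Qed.

Lemma cc_shift (n : nat) (z : 'rV[R]_n) (f : 'rV[R]_n -> R) :
  cc f -> cc (fun x => f (x + z)).
Proof.
move=> [cf [M fM]]; split; first exact: continuous_shiftr.
exists (M + `|z|) => x xM; apply: fM.
by have := lerB_normD x z; lra.
Qed.

(** A tent function. It turns a constant error bound on a ball into an integrable one. *)
Lemma cc_cutoff (n : nat) (M : R) :
  exists2 chi : 'rV[R]_n -> R, cc chi &
    (forall x, 0 <= chi x) /\ (forall x, `|x| <= M -> 1 <= chi x).
Proof.
exists (fun x => Num.max 0 (M + 1 - `|x|)); last first.
  by split=> x; [rewrite le_max lexx|move=> xM; rewrite le_max; apply/orP; right; lra].
split.
  move=> x; apply: (@continuous_max R _ (fun=> 0) (fun x => M + 1 - `|x|)).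
    exact: cst_continuous.
  by apply: continuousB; [exact: cst_continuous|exact: norm_continuous].
by exists (M + 1) => x xM; apply/max_idPl; lra.
Qed.

End CompactSupport.

(** * One-dimensional integrals: integrability and translation invariance *)

Section OneDim.
Context {R : realType}.
Notation mu := (@lebesgue_measure R).

Definition cc1 (f : R -> R) : Prop :=
  continuous f /\ exists M, forall x, M < `|x| -> f x = 0.

Lemma cc1_integrable (f : R -> R) : cc1 f -> mu.-integrable setT (EFin \o f).
Proof.
move=> [cf [M fM]].
have -> : EFin \o f = (EFin \o f) \_ (`[- M, M]%classic).
  apply/funext => x; rewrite patchE; case: ifPn => //= xM.
  rewrite fM// ltNge; apply: contra xM => xM.
  by rewrite inE /= in_itv /= -ler_norml.
have := @continuous_compact_integrable R f (`[- M, M]%classic)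
  (@segment_compact _ _ _) (continuous_subspaceT cf).
by move=> h; apply: (integrable_mkcond _ _).1 h; exact: measurable_itv.
Qed.

(** Change of variables is applied to nonnegative functions only, hence the splitting into positive
    and negative parts. *)
Lemma cc1_translate (f : R -> R) (a : R) : cc1 f -> 
  Rintegral mu setT (fun t => f (t + a)) = Rintegral mu setT f.
Proof.
move=> cf.
have H0 (g : R -> R) : continuous g -> (forall x, 0 <= g x) ->
  (\int[mu]_x (g x)%:E = \int[mu]_x (g (x + a))%:E)%E.
  move=> cg g0.
  have dF x : is_derive x (1:R) (fun t : R => t + a) 1.
    by apply: is_derive_eq; rewrite addr0.
  have F1 : (fun t : R => t + a)^`()%classic = cst 1.
    by apply/funext => x; rewrite derive1E; apply: derive_val.
  rewrite (@increasing_ge0_integration_by_substitutionT R (fun t => t + a) g)//.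
  - by apply: eq_integral => x _; rewrite F1 fctE /= mulr1.
  - by move=> x y xy; rewrite ltrD2r.
  - by rewrite F1; move=> x; exact: cst_continuous.
  - by rewrite F1; exact: is_cvg_cst.
  - by rewrite F1; exact: is_cvg_cst.
  - move=> A [M [Mr MA]]; exists (M - a); split; first exact: num_real.
    by move=> x xM; apply: MA; rewrite -ltrBrDr.
  - move=> A [M [Mr MA]]; exists (M - a); split; first exact: num_real.
    by move=> x xM; apply: MA; rewrite -ltrBlDr.
pose p x := Num.max 0 (f x); pose q x := Num.max 0 (- f x).
have fpq x : f x = p x - q x.
  by rewrite /p /q; have [h|h] := leP 0 (f x); [rewrite max_l|rewrite max_r]; lra.
have cp : cc1 p.
  split; last by case: cf.2 => M fM; exists M => x /fM fx; rewrite /p fx maxxx.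
  by move=> x; apply: (@continuous_max R R (fun=> 0) f x); [exact: cst_continuous|exact: cf.1].
have cq : cc1 q.
  split; last by case: cf.2 => M fM; exists M => x /fM fx; rewrite /q fx oppr0 maxxx.
  move=> x; apply: (@continuous_max R R (fun=> 0) (fun t => - f t) x); first exact: cst_continuous.
  by apply: continuousN; exact: cf.1.
have cs g : cc1 g -> cc1 (fun t => g (t + a)).
  move=> [cg [M gM]]; split.
    move=> x; apply: continuous_comp; last exact: cg.
    by apply: continuousD => //; exact: cst_continuous.
  by exists (M + `|a|) => x xM; apply: gM; have := lerB_normD x a; lra.
rewrite (_ : f = fun x => p x - q x); last exact/funext.
rewrite RintegralB//; [|exact/cc1_integrable/(cs p)|exact/cc1_integrable/(cs q)].
rewrite RintegralB//; [|exact: cc1_integrable|exact: cc1_integrable].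
rewrite /Rintegral -(H0 p)//; [|exact: cp.1|by move=> x; rewrite le_max lexx].
by rewrite -(H0 q)//; [exact: cq.1|move=> x; rewrite le_max lexx].
Qed.

End OneDim.

(** * The iterated integral *)

Section IntegralRn.
Context {R : realType}.
Notation mu := (@lebesgue_measure R).

Lemma cons_row0 (n : nat) (t : R) (v : 'rV[R]_n) : cons_row t v ord0 ord0 = t.
Proof. by rewrite mxE unlift_none. Qed.

Lemma cons_rowS (n : nat) (t : R) (v : 'rV[R]_n) (i : 'I_n) :
  cons_row t v ord0 (lift ord0 i) = v ord0 i.
Proof. by rewrite mxE liftK. Qed.

Lemma cons_rowD (n : nat) (t s : R) (v w : 'rV[R]_n) :
  cons_row t v + cons_row s w = cons_row (t + s) (v + w).
Proof. by apply/rowP => i; rewrite !mxE; case: unliftP => [j|] _; rewrite ?mxE. Qed.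

Lemma cons_rowB (n : nat) (t s : R) (v w : 'rV[R]_n) :
  cons_row t v - cons_row s w = cons_row (t - s) (v - w).
Proof. by apply/rowP => i; rewrite !mxE; case: unliftP => [j|] _; rewrite ?mxE. Qed.

Lemma cons_row_surj (n : nat) (x : 'rV[R]_n.+1) :
  x = cons_row (x ord0 ord0) (\row_i x ord0 (lift ord0 i)).
Proof.
by apply/rowP => i; rewrite !mxE; case: unliftP => [j|] ->; rewrite ?mxE.
Qed.

Lemma cons_row_norm_le (n : nat) (t : R) (v : 'rV[R]_n) :
  `|cons_row t v| <= Num.max `|t| `|v|.
Proof.
apply: rV_norm_le => [|i]; first by rewrite le_max normr_ge0.
rewrite mxE le_max; case: unliftP => [j|] _; last by rewrite lexx.
by rewrite rV_coord_le orbT.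
Qed.

Lemma le_cons_row_normr (n : nat) (t : R) (v : 'rV[R]_n) : `|v| <= `|cons_row t v|.
Proof.
by apply: rV_norm_le => // i; rewrite -(cons_rowS t); exact: rV_coord_le.
Qed.

Lemma le_cons_row_norml (n : nat) (t : R) (v : 'rV[R]_n) : `|t| <= `|cons_row t v|.
Proof. by rewrite -{1}(cons_row0 t v); exact: rV_coord_le. Qed.

Lemma cc_slice (n : nat) (f : 'rV[R]_n.+1 -> R) (t : R) :
  cc f -> cc (fun v => f (cons_row t v)).
Proof.
move=> cf; split.
  apply: eps_continuous => v e e0.
  have [d d0 Hd] := cc_unif cf e0; exists d => // w vw.
  apply: Hd; rewrite cons_rowB subrr (le_lt_trans (cons_row_norm_le _ _))//.
  by rewrite normr0 gt_max d0.
have [_ [M fM]] := cf.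
by exists M => v Mv; apply: fM; exact: (lt_le_trans Mv (le_cons_row_normr _ _)).
Qed.

(** Linearity and positivity are carried together through the induction on the dimension: in
    dimension [n] they give continuity of the slice integrals, hence integrability of the outer
    integrand in dimension [n.+1]. *)
Let linear_pos n := (forall (a : R) (f g : 'rV[R]_n -> R), cc f -> cc g ->
    integral_Rn (fun x => a * f x + g x) = a * integral_Rn f + integral_Rn g) /\
  (forall f : 'rV[R]_n -> R, cc f -> (forall x, 0 <= f x) -> 0 <= integral_Rn f).

(** By uniform continuity, nearby slices differ by at most [e'] on the ball of radius [M] and agree
    off it, so their integrals differ by at most [e'] times the integral of [chi]. *)
Let lp_cc1 n : linear_pos n -> forall f : 'rV[R]_n.+1 -> R, cc f ->
  cc1 (fun t => integral_Rn (fun v => f (cons_row t v))).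
Proof.
move=> [lin pos] f cf.
have Z (g h : 'rV[R]_n -> R) : cc g -> cc h -> (forall x, g x <= h x) ->
    integral_Rn g <= integral_Rn h.
  move=> cg ch gh; rewrite -subr_ge0.
  have := pos (fun x => -1 * g x + h x).
  rewrite lin// mulN1r addrC; apply; first exact: ccD (ccZ _ cg) ch.
  by move=> x; rewrite mulN1r addrC subr_ge0.
have [_ [M fM]] := cf.
have [chi cchi [chi0 chi1]] := cc_cutoff n M.
split; last first.
  exists M => t Mt.
  (* The zero slice is written as a combination with coefficients 0, so that linearity alone shows
     that its integral is 0. *)
  have -> : (fun v : 'rV[R]_n => f (cons_row t v)) = (fun v => 0 * chi v + 0 * chi v).
    apply/funext => v; rewrite fM ?mul0r ?addr0//.
    exact: (lt_le_trans Mt (le_cons_row_norml _ _)).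
  rewrite lin//; last exact: ccZ.
  rewrite mul0r add0r.
  by have := lin 1 _ _ (ccZ 0 cchi) (ccZ 0 cchi);
    rewrite (_ : (fun x => 1 * (0 * chi x) + 0 * chi x) = (fun x => 0 * chi x));
    [lra|apply/funext => x; ring].
apply: eps_continuous => t e e0.
have K0 : 0 <= integral_Rn chi by exact: pos.
have e0' : 0 < e / (integral_Rn chi + 1) by rewrite divr_gt0// ltr_wpDl.
have [d d0 Hd] := cc_unif cf e0'.
exists d => // s ts.
set e' := e / _ in e0' Hd.
have H r1 r2 : `|r1 - r2| < d ->
    integral_Rn (fun v => f (cons_row r1 v)) - integral_Rn (fun v => f (cons_row r2 v)) <=
    e' * integral_Rn chi.
  move=> rd; rewrite lerBlDr -lin//; last exact: cc_slice.
  apply: Z; first exact: cc_slice.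
    by apply: ccD; [exact: ccZ|exact: cc_slice].
  move=> v; have [vM|Mv] := leP `|v| M; last first.
    have f0 r : f (cons_row r v) = 0.
      by apply: fM; exact: (lt_le_trans Mv (le_cons_row_normr _ _)).
    by rewrite !f0 addr0 mulr_ge0// ltW.
  have : `|f (cons_row r1 v) - f (cons_row r2 v)| < e'.
    apply: Hd; rewrite cons_rowB subrr (le_lt_trans (cons_row_norm_le _ _))//.
    by rewrite normr0 gt_max d0 rd.
  rewrite ltr_norml => /andP[_ h].
  have : e' * 1 <= e' * chi v by rewrite ler_pM2l// chi1.
  by lra.
have Hlt : e' * integral_Rn chi < e.
  rewrite /e' mulrAC ltr_pdivrMr ?ltr_wpDl//; rewrite ltr_pM2l//; lra.
apply: le_lt_trans Hlt.
by rewrite ler_norml; have := H _ _ ts; have := H s t; rewrite distrC => /(_ ts); lra.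
Qed.

Let lp n : linear_pos n.
Proof.
elim: n => [|n IH]; first by split => //= f _; exact.
split=> [a f g cf cg|f cf f0] /=.
  rewrite -RintegralZl//; last exact: cc1_integrable (lp_cc1 IH cf).
  rewrite -RintegralD//; first last.
  - exact: cc1_integrable (lp_cc1 IH cg).
  - have := cc1_integrable (lp_cc1 IH (ccZ a cf)).
    congr (_.-integrable _ _); apply/funext => t /=; congr EFin.
    have := IH.1 a _ _ (cc_slice t cf) (cc0 n).
    rewrite (_ : (fun x => _) = (fun v => a * f (cons_row t v))); last first.
      by apply/funext => v; rewrite addr0.
    move=> ->; have := IH.1 1 _ _ (cc0 n) (cc0 n).
    rewrite (_ : (fun x => 1 * 0 + 0) = (fun x => 0)); first lra.
    by apply/funext => v; rewrite mulr0 addr0.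
  congr (Rintegral _ _ _); apply/funext => t.
  by rewrite (IH.1 a)//; exact: cc_slice.
apply: Rintegral_ge0 => t _; apply: IH.2; first exact: cc_slice.
by move=> v; exact: f0.
Qed.

Lemma slice_cc1 (n : nat) (f : 'rV[R]_n.+1 -> R) : cc f ->
  cc1 (fun t => integral_Rn (fun v => f (cons_row t v))).
Proof. exact: lp_cc1. Qed.

Lemma intR0 (n : nat) : integral_Rn (fun _ : 'rV[R]_n => 0) = 0.
Proof.
have := (lp n).1 1 _ _ (cc0 n) (cc0 n).
rewrite (_ : (fun x => 1 * 0 + 0) = (fun x => 0)); first lra.
by apply/funext => v; rewrite mulr0 addr0.
Qed.

Lemma intRZ (n : nat) (a : R) (f : 'rV[R]_n -> R) : cc f ->
  integral_Rn (fun x => a * f x) = a * integral_Rn f.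
Proof.
move=> cf; have := (lp n).1 a _ _ cf (cc0 n); rewrite intR0 addr0 => <-.
by congr integral_Rn; apply/funext => x; rewrite addr0.
Qed.

Lemma intRD (n : nat) (f g : 'rV[R]_n -> R) : cc f -> cc g ->
  integral_Rn (fun x => f x + g x) = integral_Rn f + integral_Rn g.
Proof.
move=> cf cg; have := (lp n).1 1 _ _ cf cg; rewrite mul1r => <-.
by congr integral_Rn; apply/funext => x; rewrite mul1r.
Qed.

Lemma intRB (n : nat) (f g : 'rV[R]_n -> R) : cc f -> cc g ->
  integral_Rn (fun x => f x - g x) = integral_Rn f - integral_Rn g.
Proof.
move=> cf cg; have := (lp n).1 (-1) _ _ cg cf; rewrite mulN1r addrC => <-.
by congr integral_Rn; apply/funext => x; rewrite mulN1r addrC.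
Qed.

Lemma intR_sum (n m : nat) (f : 'I_m -> 'rV[R]_n -> R) : (forall i, cc (f i)) ->
  integral_Rn (fun x => \sum_i f i x) = \sum_i integral_Rn (f i).
Proof.
elim: m f => [|m IH] f cf.
  by rewrite big_ord0 -[RHS](intR0 n); congr integral_Rn; apply/funext => x; rewrite big_ord0.
rewrite big_ord_recl -IH// -intRD//; last exact: cc_sum.
by congr integral_Rn; apply/funext => x; rewrite big_ord_recl.
Qed.

Lemma intR_ge0 (n : nat) (f : 'rV[R]_n -> R) : cc f -> (forall x, 0 <= f x) ->
  0 <= integral_Rn f.
Proof. exact: (lp n).2. Qed.

Lemma le_intR (n : nat) (f g : 'rV[R]_n -> R) : cc f -> cc g ->
  (forall x, f x <= g x) -> integral_Rn f <= integral_Rn g.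
Proof.
move=> cf cg fg; rewrite -subr_ge0 -intRB//; apply: intR_ge0 (ccB cg cf) _ => x.
by rewrite subr_ge0.
Qed.

Lemma intR_shift (n : nat) (z : 'rV[R]_n) (f : 'rV[R]_n -> R) : cc f ->
  integral_Rn (fun x => f (x + z)) = integral_Rn f.
Proof.
elim: n z f => [|n IH] z f cf.
  by rewrite /= add0r; congr f; apply/rowP => -[].
rewrite /= -[RHS](cc1_translate (z ord0 ord0) (slice_cc1 cf)).
congr (Rintegral _ _ _); apply/funext => t.
rewrite -[RHS](IH (\row_i z ord0 (lift ord0 i)) _ (cc_slice _ cf)).
by congr integral_Rn; apply/funext => v; rewrite {1}(cons_row_surj z) cons_rowD.
Qed.

(** Summation by parts: translation by [z] turns the integral of [f x * g (x - z)] into that of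
    [f (x + z) * g x], and one of the two copies of [f x * g x] into [f (x + z) * g (x + z)]. *)
Lemma intR_second_diff (n : nat) (z : 'rV[R]_n) (f g : 'rV[R]_n -> R) :
  cc f -> continuous g ->
  integral_Rn (fun x => f x * (2 * g x - g (x + z) - g (x - z))) =
  integral_Rn (fun x => (f (x + z) - f x) * (g (x + z) - g x)).
Proof.
move=> cf cg.
have c0 : cc (fun x => f x * g x) by exact: ccMr.
have c1 : cc (fun x => f x * g (x + z)) by exact: ccMr cf (continuous_shiftr (z := z) cg).
have c2 : cc (fun x => f x * g (x - z)) by exact: ccMr cf (continuous_shiftr (z := - z) cg).
have s0 := intR_shift z c0; have s2 := intR_shift z c2.
have c0' := cc_shift z c0; have c2' := cc_shift z c2.
transitivity (2 * integral_Rn (fun x => f x * g x) -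
   integral_Rn (fun x => f x * g (x + z)) - integral_Rn (fun x => f x * g (x - z))).
  rewrite -intRZ// -intRB//; last exact: ccZ.
  rewrite -intRB//; last by apply: ccB => //; exact: ccZ.
  by congr integral_Rn; apply/funext => x; ring.
rewrite -s2 mulr_natl mulr2n -{1}s0 -intRD// -intRB//; last exact: ccD.
rewrite -intRB//; last by apply: ccB => //; exact: ccD.
by congr integral_Rn; apply/funext => x; rewrite addrK; ring.
Qed.

(** The second difference operator is symmetric: translations by [- z] and [z] exchange the two
    mixed terms. *)
Lemma intR_second_diff_sym (n : nat) (z : 'rV[R]_n) (f g : 'rV[R]_n -> R) :
  cc f -> continuous g ->
  integral_Rn (fun x => f x * (2 * g x - g (x + z) - g (x - z))) =
  integral_Rn (fun x => g x * (2 * f x - f (x + z) - f (x - z))).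
Proof.
move=> cf cg.
have c0 : cc (fun x => f x * g x) by exact: ccMr.
have c1 : cc (fun x => f x * g (x + z)) by exact: ccMr cf (continuous_shiftr (z := z) cg).
have c2 : cc (fun x => f x * g (x - z)) by exact: ccMr cf (continuous_shiftr (z := - z) cg).
have s1 := intR_shift (- z) c1; have s2 := intR_shift z c2.
have c1' := cc_shift (- z) c1; have c2' := cc_shift z c2.
transitivity (2 * integral_Rn (fun x => f x * g x) -
   integral_Rn (fun x => f x * g (x + z)) - integral_Rn (fun x => f x * g (x - z))).
  rewrite -intRZ// -intRB//; last exact: ccZ.
  rewrite -intRB//; last by apply: ccB => //; exact: ccZ.
  by congr integral_Rn; apply/funext => x; ring.
rewrite -s1 -s2 -intRZ// -intRB//; last exact: ccZ.
rewrite -intRB//; last by apply: ccB => //; exact: ccZ.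
by congr integral_Rn; apply/funext => x; rewrite addrK subrK; ring.
Qed.

End IntegralRn.

(** * The distance function *)

Section Distance.
Context {R : realType}.

Lemma sumsq_ge0 (n : nat) (v : 'rV[R]_n) : 0 <= \sum_(i < n) v ord0 i ^+ 2.
Proof. by apply: sumr_ge0 => i _; exact: sqr_ge0. Qed.

Lemma enorm_ge0 (n : nat) (v : 'rV[R]_n) : 0 <= enorm v.
Proof. exact: sqrtr_ge0. Qed.

Lemma enorm_sqr (n : nat) (v : 'rV[R]_n) : enorm v ^+ 2 = \sum_(i < n) v ord0 i ^+ 2.
Proof. by rewrite sqr_sqrtr// sumsq_ge0. Qed.

Lemma le_coord_enorm (n : nat) (v : 'rV[R]_n) (i : 'I_n) : `|v ord0 i| <= enorm v.
Proof.
rewrite -(ler_pXn2r (n := 2))// ?nnegrE ?enorm_ge0// enorm_sqr.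
rewrite real_normK ?num_real// (bigD1 i)//= lerDl.
by apply: sumr_ge0 => j _; exact: sqr_ge0.
Qed.

Lemma enorm_eq0P (n : nat) (v : 'rV[R]_n) : enorm v = 0 -> v = 0.
Proof.
move=> v0; apply/rowP => i; rewrite mxE; apply/eqP.
by rewrite -normr_le0 -v0 le_coord_enorm.
Qed.

(** Expand the sum of the squares of [enorm b * a_i - enorm a * b_i] and divide by
    [enorm a * enorm b]; zero vectors are treated apart because of this division. *)
Lemma cauchy_schwarz (n : nat) (a b : 'rV[R]_n) :
  \sum_(i < n) a ord0 i * b ord0 i <= enorm a * enorm b.
Proof.
have [a0|a0] := eqVneq (enorm a) 0.
  rewrite a0 mul0r (enorm_eq0P a0) big1// => i _; by rewrite mxE mul0r.
have [b0|b0] := eqVneq (enorm b) 0.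
  rewrite b0 mulr0 (enorm_eq0P b0) big1// => i _; by rewrite mxE mulr0.
have A0 : 0 < enorm a by rewrite lt_def a0 enorm_ge0.
have B0 : 0 < enorm b by rewrite lt_def b0 enorm_ge0.
have : 0 <= \sum_(i < n) (enorm b * a ord0 i - enorm a * b ord0 i) ^+ 2.
  by apply: sumr_ge0 => i _; exact: sqr_ge0.
have -> : \sum_(i < n) (enorm b * a ord0 i - enorm a * b ord0 i) ^+ 2 =
    enorm b ^+ 2 * (\sum_(i < n) a ord0 i ^+ 2)
    + enorm a ^+ 2 * (\sum_(i < n) b ord0 i ^+ 2) - 2 * (enorm a * enorm b) * \sum_(i < n) a ord0 i * b ord0 i.
  rewrite !mulr_sumr -big_split/= -sumrB.
  by apply: eq_bigr => i _; ring.
rewrite -!enorm_sqr; have AB : 0 < enorm a * enorm b by exact: mulr_gt0.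
by move=> H; rewrite -(ler_pM2l AB); lra.
Qed.

Lemma enormN (n : nat) (v : 'rV[R]_n) : enorm (- v) = enorm v.
Proof.
by rewrite /enorm; congr Num.sqrt; apply: eq_bigr => i _; rewrite mxE sqrrN.
Qed.

Lemma enormD_sqr (n : nat) (v w : 'rV[R]_n) : enorm (v + w) ^+ 2 =
  enorm v ^+ 2 + 2 * \sum_(i < n) v ord0 i * w ord0 i + enorm w ^+ 2.
Proof.
rewrite !enorm_sqr mulr_sumr -!big_split/=; apply: eq_bigr => i _.
by rewrite mxE; ring.
Qed.

Lemma ler_enormD (n : nat) (v w : 'rV[R]_n) : enorm (v + w) <= enorm v + enorm w.
Proof.
rewrite -(ler_pXn2r (n := 2))// ?nnegrE ?addr_ge0 ?enorm_ge0//.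
by rewrite enormD_sqr; have := cauchy_schwarz v w; nra.
Qed.

Lemma enorm_le_norm (n : nat) (v : 'rV[R]_n) : enorm v <= n%:R * `|v|.
Proof.
have v0 : 0 <= n%:R * `|v| by rewrite mulr_ge0.
rewrite -(ler_pXn2r (n := 2))// ?nnegrE ?enorm_ge0// enorm_sqr.
case: n v v0 => [v _|n v v0]; first by rewrite big_ord0 sqr_ge0.
apply: (@le_trans _ _ (\sum_(i < n.+1) `|v| ^+ 2)).
  apply: ler_sum => i _; rewrite -[leLHS]real_normK ?num_real//.
  by rewrite ler_pXn2r// ?nnegrE// rV_coord_le.
rewrite sumr_const card_ord -[leLHS]mulr_natl exprMn ler_wpM2r ?sqr_ge0//.
by rewrite expr2 ler_peMl// ler1n.
Qed.

Lemma norm_le_enorm (n : nat) (v : 'rV[R]_n) : `|v| <= enorm v.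
Proof. by apply: rV_norm_le (enorm_ge0 _) _ => i; exact: le_coord_enorm. Qed.

Lemma enorm_basis (n : nat) (i : 'I_n) (r : R) : enorm (r *: basis_vec R i) = `|r|.
Proof.
rewrite /enorm -sqrtr_sqr; congr Num.sqrt; rewrite (bigD1 i)//= !mxE eqxx mulr1.
rewrite big1 ?addr0// => j ji; by rewrite !mxE (negbTE ji) mulr0 expr0n.
Qed.

Lemma lip_continuous (n : nat) (C : R) (f : 'rV[R]_n -> R) :
  (forall x y, `|f x - f y| <= C * enorm (x - y)) -> continuous f.
Proof.
move=> fC; apply: eps_continuous => x e e0.
have K0 : 0 < `|C| * n%:R + 1 by rewrite ltr_wpDl// mulr_ge0.
exists (e / (`|C| * n%:R + 1)); first by rewrite divr_gt0.
move=> y; rewrite ltr_pdivlMr// => xy; apply: le_lt_trans (fC x y) _.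
apply: le_lt_trans xy.
have h1 : C * enorm (x - y) <= `|C| * enorm (x - y).
  by rewrite ler_wpM2r ?enorm_ge0// ler_norm.
have h2 : `|C| * enorm (x - y) <= `|C| * (n%:R * `|x - y|).
  by rewrite ler_wpM2l// enorm_le_norm.
by have := normr_ge0 (x - y); lra.
Qed.

Variables (n : nat) (Omega : set 'rV[R]_n).
Local Notation d := (dist_compl Omega).

Let S x := [set enorm (x - y) | y in ~` Omega].

Let S_lb x : lbound (S x) 0.
Proof. by move=> _ [y _ <-]; exact: enorm_ge0. Qed.

Lemma dist_compl_le (x y : 'rV[R]_n) : ~ Omega y -> d x <= enorm (x - y).
Proof. by move=> Oy; apply: ge_inf; [exists 0; exact: S_lb|exists y]. Qed.

Lemma dist_compl_out (x : 'rV[R]_n) : ~ Omega x -> d x <= 0.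
Proof.
move=> /(dist_compl_le x); rewrite subrr.
rewrite /enorm => /le_trans; apply.
rewrite big1 ?sqrtr0// => i _; by rewrite mxE expr0n.
Qed.

Hypothesis nT : exists y, ~ Omega y.

Let S_has_inf x : has_inf (S x).
Proof.
by split; [case: nT => y ny; exists (enorm (x - y)); exists y|exists 0; exact: S_lb].
Qed.

Lemma dist_compl_ge0 (x : 'rV[R]_n) : 0 <= d x.
Proof. by apply: lb_le_inf; [case: (S_has_inf x)|exact: S_lb]. Qed.

Lemma dist_compl_adherent (x : 'rV[R]_n) (e : R) : 0 < e ->
  exists2 y, ~ Omega y & enorm (x - y) < d x + e.
Proof. by move=> e0; case: (inf_adherent e0 (S_has_inf x)) => _ [y Oy <-]; exists y. Qed.

Lemma dist_compl_ge (x : 'rV[R]_n) (C : R) :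
  (forall y, ~ Omega y -> C <= enorm (x - y)) -> C <= d x.
Proof.
by move=> H; apply: lb_le_inf; [case: (S_has_inf x)|move=> _ [y Oy <-]; exact: H].
Qed.

Lemma dist_compl_lip1 (x y : 'rV[R]_n) : d x - d y <= enorm (x - y).
Proof.
rewrite lerBlDl -lerBlDr; apply: dist_compl_ge => z Oz.
rewrite lerBlDr (le_trans (dist_compl_le x Oz))//.
by have := ler_enormD (x - y) (y - z); rewrite addrA subrK [leRHS]addrC.
Qed.

Lemma dist_compl_lip (x y : 'rV[R]_n) : `|d x - d y| <= enorm (x - y).
Proof.
rewrite ler_norml; have := dist_compl_lip1 x y; have := dist_compl_lip1 y x.
rewrite -(enormN (y - x)) opprB => h1 h2; apply/andP; split; lra.
Qed.

Lemma dist_compl_continuous : continuous d.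
Proof. by apply: (@lip_continuous _ 1) => x y; rewrite mul1r dist_compl_lip. Qed.

Lemma dist_compl_gt0 (x : 'rV[R]_n) : open Omega -> Omega x -> 0 < d x.
Proof.
move=> oO Ox; have /nbhs_ballP[e /= e0 eO] : nbhs x Omega by exact: open_nbhs_nbhs.
apply: (lt_le_trans e0); apply: dist_compl_ge => y Oy.
rewrite leNgt; apply/negP => xy; apply: Oy; apply: eO.
by rewrite -ball_normE /=; exact: le_lt_trans (norm_le_enorm _) xy.
Qed.

(* The unit vector [e] points from an almost nearest point [y] of the complement
   towards [x]; then [d (x + z) <= enorm (x - y + z)], and expand the square root. *)
Lemma dist_compl_semiconcave (x : 'rV[R]_n) (delta eta : R) :
  0 < delta -> delta <= d x -> 0 < eta ->
  exists e : 'rV[R]_n, enorm e = 1 /\ forall z,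
    d (x + z) - d x <= \sum_(i < n) e ord0 i * z ord0 i
      + enorm z ^+ 2 / (2 * delta) + eta.
Proof.
move=> d0 dx eta0; have [y Oy xy] := dist_compl_adherent x eta0.
set a := enorm (x - y) in xy.
have da : d x <= a by exact: dist_compl_le.
have a0 : 0 < a by lra.
exists (a^-1 *: (x - y)); split.
  rewrite /enorm (eq_bigr (fun i => a^-1 ^+ 2 * (x - y) ord0 i ^+ 2)); last first.
    by move=> i _; rewrite mxE exprMn.
  by rewrite -mulr_sumr -enorm_sqr -exprMn sqrtr_sqr -/a mulVf ?gt_eqF// normr1.
move=> z; have := dist_compl_le (x + z) Oy.
rewrite addrAC; set b := enorm _ => db.
have b0 : 0 <= b by exact: enorm_ge0.
have bE : b ^+ 2 = a ^+ 2 + 2 * \sum_(i < n) (x - y) ord0 i * z ord0 i + enorm z ^+ 2.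
  by rewrite enormD_sqr.
set t := \sum_(i < n) _ in bE.
have -> : \sum_(i < n) (a^-1 *: (x - y)) ord0 i * z ord0 i = a^-1 * t.
  by rewrite mulr_sumr; apply: eq_bigr => i _; rewrite mxE mulrA.
(* This is [b <= (a^2 + b^2) / (2 a)], that is [(a - b)^2 >= 0]; it replaces an expansion of the
   square root. *)
have h : b <= a + a^-1 * t + enorm z ^+ 2 / (2 * a).
  have -> : a + a^-1 * t + enorm z ^+ 2 / (2 * a) = (a ^+ 2 + b ^+ 2) / (2 * a).
    by rewrite bE; field; rewrite gt_eqF.
  by rewrite ler_pdivlMr ?mulr_gt0//; have := sqr_ge0 (a - b); rewrite !expr2; lra.
have : enorm z ^+ 2 / (2 * a) <= enorm z ^+ 2 / (2 * delta).
  rewrite ler_wpM2l ?sqr_ge0// lef_pV2 ?posrE ?mulr_gt0// ler_pM2l//; lra.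
by lra.
Qed.

(** Semiconcavity is used at [z] and [- z] with slack [eta = r^2], whence the summand [1] in the
    constant. With [X] for that constant times [r^2], the upper bound at [- z] and the second
    difference bound [d (x + z) - d x] from below. The two bounds add up to second difference
    [>= - 2 X], which is why [3 X] suffices on both sides. The same unit vector serves all
    coordinates. *)
Lemma dist_compl_directions (x : 'rV[R]_n) (delta r : R) :
  0 < delta -> delta <= d x -> 0 < r ->
  exists e : 'rV[R]_n, enorm e = 1 /\ forall i z,
    z = r *: basis_vec R i ->
    `|r * e ord0 i - (d (x + z) - d x)| <=
      2 * d x - d (x + z) - d (x - z) + 3 * ((1 / (2 * delta) + 1) * r ^+ 2).
Proof.
move=> delta0 dx r0; have r20 : 0 < r ^+ 2 by rewrite exprn_gt0.
have [e [e1 He]] := dist_compl_semiconcave delta0 dx r20.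
exists e; split=> // i z zE; have h1 := He z; have h2 := He (- z).
have S1 (t : R) : \sum_(j < n) e ord0 j * (t *: basis_vec R i) ord0 j = t * e ord0 i.
  rewrite (bigD1 i)//= big1 ?addr0; last first.
    by move=> j ji; rewrite !mxE (negbTE ji) !mulr0.
  by rewrite !mxE eqxx mulr1 mulrC.
rewrite {2 3}zE S1 enorm_basis real_normK ?num_real// in h1.
rewrite {2 3}zE -scaleNr S1 enorm_basis normrN real_normK ?num_real// in h2.
set C := 1 / (2 * delta) + 1.
have CE : r ^+ 2 / (2 * delta) + r ^+ 2 = C * r ^+ 2 by rewrite /C; field; rewrite gt_eqF.
have C0 : 0 <= C * r ^+ 2.
  by apply: mulr_ge0; [rewrite addr_ge0// divr_ge0// mulr_ge0// ltW|exact: sqr_ge0].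
rewrite ler_norml; set X := C * r ^+ 2 in CE C0 *.
by apply/andP; split; lra.
Qed.

End Distance.

(** * Taylor estimates *)

Section Calculus.
Context {R : realType}.

Lemma is_derive_line (n : nat) (f : 'rV[R]_n -> R) (x v : 'rV[R]_n) (t : R) :
  differentiable f (x + t *: v) ->
  is_derive t (1 : R) (fun t => f (x + t *: v)) ('D_v f (x + t *: v)).
Proof.
move=> dfx; have df : derivable f (x + t *: v) v by exact: diff_derivable.
have E : (fun h : R => h^-1 *: (((fun t => f (x + t *: v)) \o shift t) (h *: (1 : R))
      - f (x + t *: v))) =
    (fun h : R => h^-1 *: ((f \o shift (x + t *: v)) (h *: v) - f (x + t *: v))).
  apply/funext => h /=; congr (_ *: (f _ - _)).
  by rewrite [h *: 1]mulr1 scalerDl addrCA.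
by split; rewrite /derivable /derive E.
Qed.

Lemma mvt_bound (f df : R -> R) (b C : R) : 0 <= b ->
  (forall t, is_derive t (1 : R) f (df t)) ->
  (forall t, 0 <= t -> t <= b -> `|df t| <= C) -> `|f b - f 0| <= C * b.
Proof.
move=> b0 dff dfC.
have cf : {within `[0, b], continuous f}.
  apply: continuous_subspaceT => t.
  by apply: differentiable_continuous; apply/derivable1_diffP; by case: (dff t).
have [c] := MVT_segment b0 (fun t _ => dff t) cf.
rewrite in_itv /= subr0 => /andP[c0 cb] ->.
by rewrite normrM (ger0_norm b0) ler_wpM2r// dfC.
Qed.

Lemma partial_line (n : nat) (i : 'I_n) (f : 'rV[R]_n -> R) (x : 'rV[R]_n) (t : R) :
  (forall x, differentiable f x) ->
  is_derive t (1 : R) (fun t => f (x + t *: basis_vec R i))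
    (partial i f (x + t *: basis_vec R i)).
Proof. by move=> df; exact: is_derive_line. Qed.

Lemma taylor1 (n : nat) (i : 'I_n) (f : 'rV[R]_n -> R) (x : 'rV[R]_n) (r C : R) :
  (forall x, differentiable f x) -> 0 <= r -> (forall x, `|partial i f x| <= C) ->
  `|f (x + r *: basis_vec R i) - f x| <= C * r.
Proof.
move=> df r0 fC.
have := mvt_bound r0 (fun t => partial_line i x t df) (fun t _ _ => fC _).
by rewrite scale0r addr0.
Qed.

(** The mean value bound is applied to [f (x + t e_i) - t * partial i f x], whose derivative is at
    most [C * r] on [[0, r]] by [taylor1]. *)
Lemma taylor2 (n : nat) (i : 'I_n) (f : 'rV[R]_n -> R) (x : 'rV[R]_n) (r C : R) :
  (forall x, differentiable f x) -> (forall x, differentiable (partial i f) x) ->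
  0 <= r -> (forall x, `|partial i (partial i f) x| <= C) ->
  `|f (x + r *: basis_vec R i) - f x - r * partial i f x| <= C * r ^+ 2.
Proof.
move=> df ddf r0 fC.
have C0 : 0 <= C by apply: le_trans (fC 0).
have D t : is_derive t (1 : R) (fun t => f (x + t *: basis_vec R i) - partial i f x * t)
    (partial i f (x + t *: basis_vec R i) - partial i f x).
  have h := partial_line i x t df.
  apply: is_deriveB; apply: is_derive_eq. by rewrite /GRing.scale /= mulr1.
have := mvt_bound r0 D (C := C * r).
rewrite scale0r addr0 mulr0 subr0 => H.
rewrite expr2 mulrA addrAC (mulrC r); apply: H => t t0 tr.
by rewrite (le_trans (taylor1 _ ddf t0 fC))// ler_wpM2l.
Qed.

Lemma is_derive_opp_arg (g : R -> R) (dg t : R) : is_derive (- t) (1 : R) g dg ->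
  is_derive t (1 : R) (fun t => g (- t)) (- dg).
Proof.
move=> h; have := @is_derive1_comp R _ _ t _ _ h (is_deriveNid t 1).
by rewrite mulrN1.
Qed.

(** The symmetric combination cancels the first-order terms; two applications of the mean value
    bound to what remains give the third order in [r]. *)
Lemma second_diff_bound (g g1 g2 g3 : R -> R) (r C : R) :
  (forall t, is_derive t (1 : R) g (g1 t)) -> (forall t, is_derive t (1 : R) g1 (g2 t)) ->
  (forall t, is_derive t (1 : R) g2 (g3 t)) -> 0 <= r -> (forall t, `|g3 t| <= C) ->
  `|2 * g 0 - g r - g (- r) + r ^+ 2 * g2 0| <= 2 * C * r ^+ 3.
Proof.
move=> dg dg1 dg2 r0 gC.
have C0 : 0 <= C by apply: le_trans (gC 0).
move Eq : (g2 0) => q.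
have L t : 0 <= t -> t <= r -> `|g2 t - q| <= C * r.
  move=> t0 tr; rewrite -Eq; apply: le_trans (mvt_bound t0 dg2 (fun u _ _ => gC u)) _.
  by rewrite ler_wpM2l.
have L' t : 0 <= t -> t <= r -> `|g2 (- t) - q| <= C * r.
  move=> t0 tr; rewrite -Eq -[X in _ - g2 X]oppr0.
  have D u : is_derive u (1 : R) (fun t => g2 (- t)) (- g3 (- u)) by exact: is_derive_opp_arg.
  have B u : 0 <= u -> u <= t -> `|- g3 (- u)| <= C by rewrite normrN.
  by apply: le_trans (mvt_bound t0 D B) _; rewrite ler_wpM2l.
(* The quantity to bound is [k r - k 0]. Here [k1 0 = 0], and [k2 t] is minus the sum of the
   deviations of [g2] from [q] at [t] and [- t]. *)
pose k (t : R) := - g t - g (- t) + q * t ^+ 2.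
pose k1 (t : R) := - g1 t + g1 (- t) + q * (2 * t).
pose k2 (t : R) := - g2 t - g2 (- t) + q * 2.
have Dk t : is_derive t (1 : R) k (k1 t).
  have h12 := is_deriveB (is_deriveN (dg t)) (is_derive_opp_arg (dg (- t))).
  have h3 : is_derive t (1 : R) (fun t => q * t ^+ 2) (q * (2 * t)).
    by apply: is_derive_eq; rewrite /GRing.scale /=; ring.
  have h := is_deriveD h12 h3; rewrite opprK in h; exact: h.
have Dk1 t : is_derive t (1 : R) k1 (k2 t).
  have h12 := is_deriveD (is_deriveN (dg1 t)) (is_derive_opp_arg (dg1 (- t))).
  have h3 : is_derive t (1 : R) (fun t => q * (2 * t)) (q * 2).
    by apply: is_derive_eq; rewrite /GRing.scale /=; ring.
  exact: is_deriveD h12 h3.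
have B2 t : 0 <= t -> t <= r -> `|k2 t| <= 2 * C * r.
  move=> t0 tr; rewrite (_ : k2 t = - ((g2 t - q) + (g2 (- t) - q))); last first.
    by rewrite /k2; ring.
  rewrite normrN; apply: le_trans (ler_normD _ _) _.
  by have := L t t0 tr; have := L' t t0 tr; lra.
have B1 t : 0 <= t -> t <= r -> `|k1 t| <= 2 * C * r * r.
  move=> t0 tr; have := mvt_bound t0 Dk1 (fun u u0 ut => B2 u u0 (le_trans ut tr)).
  rewrite {2}/k1 oppr0 addNr !mulr0 addr0 subr0 => h.
  by apply: (le_trans h); rewrite ler_wpM2l// !mulr_ge0.
have := mvt_bound r0 Dk B1; rewrite /k oppr0 expr0n/= mulr0 addr0 => h.
rewrite (_ : 2 * C * r ^+ 3 = 2 * C * r * r * r); last by ring.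
apply: le_trans h; rewrite le_eqVlt; apply/orP; left; apply/eqP; congr `|_|.
by ring.
Qed.

Lemma taylor3 (n : nat) (i : 'I_n) (f : 'rV[R]_n -> R) (x : 'rV[R]_n) (r C : R) :
  (forall x, differentiable f x) -> (forall x, differentiable (partial i f) x) ->
  (forall x, differentiable (partial i (partial i f)) x) ->
  0 <= r -> (forall x, `|partial i (partial i (partial i f)) x| <= C) ->
  `|2 * f x - f (x + r *: basis_vec R i) - f (x - r *: basis_vec R i)
    + r ^+ 2 * partial i (partial i f) x| <= 2 * C * r ^+ 3.
Proof.
move=> df d2f d3f r0 fC.
have := second_diff_bound (fun t => partial_line i x t df)
  (fun t => partial_line i x t d2f) (fun t => partial_line i x t d3f) r0 (fun t => fC _).
by rewrite !scale0r !addr0 scaleNr.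
Qed.

Lemma partial_vanish (n : nat) (i : 'I_n) (f : 'rV[R]_n -> R) (x : 'rV[R]_n) :
  (\forall y \near x, f y = 0) -> partial i f x = 0.
Proof.
move=> f0; rewrite /partial; have [->|b0] := eqVneq (basis_vec R i) 0.
  exact: derive0.
rewrite (@near_eq_derive _ _ _ f (cst 0))//; exact: derive_cst.
Qed.

Lemma vanish_off_closure (n : nat) (f : 'rV[R]_n -> R) (x : 'rV[R]_n) :
  ~ closure [set x | f x != 0] x -> \forall y \near x, f y = 0.
Proof.
move=> ncl; have : open (~` closure [set x | f x != 0]).
  by apply: closed_openC; exact: closed_closure.
move=> op; have := open_nbhs_nbhs (conj op ncl).
apply: filterS => y /= ny; apply/eqP; apply: contrapT => /negP fy; apply: ny.
exact: subset_closure.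
Qed.

Lemma partial_off_closure (n : nat) (i : 'I_n) (f : 'rV[R]_n -> R) (x : 'rV[R]_n) :
  ~ closure [set x | f x != 0] x -> \forall y \near x, partial i f y = 0.
Proof.
move=> ncl; have : open (~` closure [set x | f x != 0]).
  by apply: closed_openC; exact: closed_closure.
move=> op; have := open_nbhs_nbhs (conj op ncl).
by apply: filterS => y /= ny; apply: partial_vanish; exact: vanish_off_closure.
Qed.

Lemma cc_partial (n : nat) (i : 'I_n) (f : 'rV[R]_n -> R) :
  cc f -> continuous (partial i f) -> cc (partial i f).
Proof.
move=> [_ [M fM]] cp; split=> //; exists M => x Mx; apply: partial_vanish.
have : \forall y \near x, M < `|y|.
  by have /cvgr_gt := @norm_continuous R _ x; apply.
by apply: filterS => y /fM.
Qed.

Lemma smooth_cc (n : nat) (f : 'rV[R]_n -> R) (l : seq 'I_n) :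
  smooth f -> cc f -> cc (iter_partial l f).
Proof.
move=> sf cf; elim: l => //= i l IH; apply: cc_partial => // x.
exact/differentiable_continuous/(sf (i :: l)).
Qed.

Lemma compact_support_cc (n : nat) (f : 'rV[R]_n -> R) :
  continuous f -> compact (closure [set x | f x != 0]) -> cc f.
Proof.
move=> cf /compact_bounded/ex_strict_bound_gt0[M M0 HM]; split=> //; exists M => x Mx.
apply/eqP; apply: contraTT Mx => fx; rewrite -leNgt ltW//.
by apply: HM; exact: subset_closure.
Qed.

Lemma powR_antitone (p a b : R) : p <= 0 -> 0 < a -> a <= b -> b `^ p <= a `^ p.
Proof.
move=> p0 a0 ab; rewrite -(opprK p) !(powRN _ (- p)).
rewrite lef_pV2 ?posrE ?powR_gt0//; last exact: lt_le_trans ab.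
by rewrite ge0_ler_powR ?nnegrE ?oppr_ge0//; lra.
Qed.

(** By the mean value theorem; as [p - 1 <= 0], the derivative is largest in absolute value at the
    left end [rho]. *)
Lemma powR_lipschitz (p rho a b : R) : p <= 1 -> 0 < rho -> rho <= a -> rho <= b ->
  `|a `^ p - b `^ p| <= `|p| * rho `^ (p - 1) * `|a - b|.
Proof.
move=> p1 rho0; wlog ab : a b / b <= a.
  move=> H ra rb; have [ba|/ltW ab] := leP b a; first exact: H.
  by rewrite distrC [X in _ <= _ * X]distrC; exact: H.
move=> ra rb.
have D t : t \in `]b, a[%R -> is_derive t (1 : R) (fun t : R => t `^ p) (p * t `^ (p - 1)).
  rewrite in_itv /= => /andP[bt _]; apply: is_derive1_powR; lra.
have cf : {within `[b, a], continuous (fun t : R => t `^ p)}.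
  apply: derivable_within_continuous => t; rewrite in_itv /= => /andP[bt _].
  have t0 : 0 < t by lra.
  by case: (@is_derive1_powR R p t t0).
have [c] := MVT_segment ab D cf.
rewrite in_itv /= => /andP[bc ca] ->.
rewrite !normrM ler_wpM2r// ler_wpM2l// ger0_norm ?powR_ge0//.
by apply: powR_antitone => //; lra.
Qed.

End Calculus.

(** * Smooth approximation *)

Section Ck.
Context {R : realType}.

(** A tower of [k] explicit derivatives, with no continuity asked of the last one; closure under
    sums, products and inverses becomes an induction on [k]. *)
Fixpoint Ck (k : nat) (g : R -> R) : Prop :=
  if k is k'.+1 then
    exists g', (forall t : R, is_derive t (1 : R) g (g' t)) /\ Ck k' g'
  else True.

Lemma CkW (k : nat) (g : R -> R) : Ck k.+1 g -> Ck k g.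
Proof.
elim: k g => // k IH g [g' [dg Cg']]; exists g'; split=> //; exact: IH.
Qed.

Lemma Ck_cst (k : nat) (c : R) : Ck k (fun=> c).
Proof.
elim: k c => // k IH c; exists (fun=> 0); split; last exact: IH.
by move=> t; exact: is_derive_cst.
Qed.

Lemma CkD (k : nat) (f g : R -> R) : Ck k f -> Ck k g -> Ck k (fun t => f t + g t).
Proof.
elim: k f g => // k IH f g [f' [df Cf]] [g' [dg Cg]].
exists (fun t => f' t + g' t); split; last exact: IH.
by move=> t; exact: is_deriveD.
Qed.

Lemma CkM (k : nat) (f g : R -> R) : Ck k f -> Ck k g -> Ck k (fun t => f t * g t).
Proof.
elim: k f g => // k IH f g Cf Cg.
have Cf0 := CkW Cf; have Cg0 := CkW Cg.
move: Cf Cg => [f' [df Cf]] [g' [dg Cg]].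
exists (fun t => f t * g' t + g t * f' t); split; last by apply: CkD; exact: IH.
by move=> t; exact: is_deriveM.
Qed.

Lemma is_derive_inv (g : R -> R) (t dg : R) : g t != 0 ->
  is_derive t (1 : R) g dg -> is_derive t (1 : R) (fun t => (g t)^-1) (- (g t)^-1 ^+ 2 * dg).
Proof.
move=> gt0 [ex val]; split; first exact: derivableV.
by rewrite deriveV// val -exprVn.
Qed.

Lemma CkV (k : nat) (g : R -> R) : (forall t, g t != 0) -> Ck k g ->
  Ck k (fun t => (g t)^-1).
Proof.
move=> g0; elim: k => // k IH Cg; have Cg0 := CkW Cg; move: Cg => [g' [dg Cg]].
exists (fun t => -1 * ((g t)^-1 * (g t)^-1) * g' t); split.
  move=> t; have := is_derive_inv (g0 t) (dg t).
  by rewrite expr2 -[in X in X -> _]mulN1r.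
by apply: CkM => //; apply: CkM; [exact: Ck_cst|apply: CkM; exact: IH].
Qed.

Lemma Ck_affine (k : nat) (a b : R) (g : R -> R) : Ck k g -> Ck k (fun t => g (a * t + b)).
Proof.
elim: k g => // k IH g [g' [dg Cg]].
exists (fun t => g' (a * t + b) * a); split; last by apply: CkM; [exact: IH|exact: Ck_cst].
move=> t; have h : is_derive t (1 : R) (fun t => a * t + b) a.
  by apply: is_derive_eq; rewrite /GRing.scale /=; ring.
exact: (@is_derive1_comp R g (fun t => a * t + b) t _ _ (dg _) h).
Qed.

Lemma is_derive_quadratic (f : R -> R) (C : R) : f 0 = 0 ->
  (forall h, `|f h| <= C * h ^+ 2) -> is_derive (0 : R) (1 : R) f 0.
Proof.
move=> f0 fC.
have L : (fun h : R => h^-1 *: ((f \o shift 0) (h *: (1 : R)) - f 0)) @ 0^' --> (0 : R).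
  apply/cvgrPdist_le => e e0; have K0 : 0 < `|C| + 1 by rewrite ltr_wpDl.
  apply/nbhs_ballP; exists (e / (`|C| + 1)); first by rewrite /= divr_gt0.
  move=> h; rewrite -ball_normE /= sub0r normrN ltr_pdivlMr// => he h0.
  rewrite sub0r normrN [h *: 1]mulr1 addr0 f0 subr0 normrM normfV mulrC.
  rewrite ler_pdivrMr ?normr_gt0//; apply: le_trans (fC h) _.
  have -> : h ^+ 2 = `|h| ^+ 2 by rewrite real_normK// num_real.
  have := normr_ge0 h; have := ler_norm C; set a := `|h| in he *.
  by move=> ? ?; nra.
by split; [apply/cvg_ex; exists 0|exact/cvg_lim].
Qed.

(** The classical functions [t^(-m) exp(-1/t)], extended by 0. The powers make the family stable
    under differentiation up to linear combinations. *)
Definition flat (m : nat) (t : R) : R :=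
  if 0 < t then t^-1 ^+ m * expR (- t^-1) else 0.

(** With [y = 1/t] and [N = m + 2], the bound [exp y >= (y / N)^N] gives [y^m exp(-y) <= N^N / y^2].
    Quadratic decay makes the derivative at 0 vanish. *)
Lemma flat_le (m : nat) (t : R) : `|flat m t| <= (m.+2%:R ^+ m.+2) * t ^+ 2.
Proof.
rewrite /flat; case: ifPn => t0; last first.
  by rewrite normr0 mulr_ge0 ?sqr_ge0 ?exprn_ge0.
have y0 : 0 < t^-1 by rewrite invr_gt0.
rewrite ger0_norm ?mulr_ge0 ?expR_ge0 ?exprn_ge0 ?(ltW y0)//.
have h : (t^-1 / m.+2%:R) ^+ m.+2 <= expR t^-1.
  have {2}-> : t^-1 = m.+2%:R * (t^-1 / m.+2%:R) by rewrite mulrC divfK// gt_eqF.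
  rewrite expRM_natl lerXn2r// ?nnegrE ?expR_ge0//.
    by rewrite divr_ge0// ltW.
  by apply: le_trans (expR_ge1Dx _); rewrite lerDr.
rewrite expRN ler_pdivrMr ?expR_gt0//.
have N0 : (0 : R) < m.+2%:R ^+ m.+2 by rewrite exprn_gt0.
apply: (@le_trans _ _ (m.+2%:R ^+ m.+2 * t ^+ 2 * (t^-1 / m.+2%:R) ^+ m.+2)); last first.
  by rewrite ler_pM2l// mulr_gt0// exprn_gt0.
rewrite le_eqVlt; apply/orP; left; apply/eqP.
have e1 : t ^+ 2 * t^-1 ^+ m.+2 = t^-1 ^+ m.
  by rewrite -[m.+2]add2n exprD mulrA -exprMn mulfV ?gt_eqF// expr1n mul1r.
have e2 : m.+2%:R ^+ m.+2 * m.+2%:R^-1 ^+ m.+2 = 1 :> R.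
  by rewrite -exprMn mulfV ?gt_eqF// expr1n.
by rewrite exprMn [X in _ * X]mulrC mulrACA e2 e1 mul1r.
Qed.

Lemma is_derive_flat (m : nat) (t : R) :
  is_derive t (1 : R) (flat m) (- m%:R * flat m.+1 t + flat m.+2 t).
Proof.
have [t0|t0|->] := ltgtP t 0.
- have -> : - m%:R * flat m.+1 t + flat m.+2 t = 0.
    by rewrite /flat !ltNge (ltW t0)/= mulr0 addr0.
  apply: (@near_eq_is_derive _ _ _ (cst 0)).
  have : \forall y \near t, y < 0 by exact: lt_nbhsl.
  by apply: filterS => y y0; rewrite /flat ltNge (ltW y0).
- have tn0 : t != 0 by rewrite gt_eqF.
  have dV : is_derive t (1 : R) (fun t : R => t^-1) (- t^-1 ^+ 2).
    by have := is_derive_inv (g := id) tn0 (is_derive_id t 1); rewrite mulr1.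
  have dX := is_deriveX m dV.
  have dE := @is_derive1_comp R expR (fun t : R => - t^-1) t _ _ (is_derive_expR _) (is_deriveN dV).
  have h := is_deriveM dX dE.
  have near_flat : \forall y \near t, ((fun t : R => t^-1) ^+ m * (expR \o (fun t : R => - t^-1))) y = flat m y.
    have : \forall y \near t, 0 < y by exact: lt_nbhsr.
    by apply: filterS => y y0; rewrite !fctE /flat y0.
  apply: (near_eq_is_derive near_flat); apply: (is_derive_eq h); rewrite /flat t0.
  rewrite /GRing.scale /= opprK; case: m {near_flat} dX h => [|m] dX h.
    by rewrite /= !expr0 (_ : (1 : R -> R) t = 1)// ?mulr0n; ring.
  have -> : ((fun t : R => t^-1) ^+ m.+1) t = t^-1 ^+ m.+1 by rewrite exprfctE.
  rewrite -pred_Sn; move: (t^-1) (expR _) (m.+1%:R : R) => y E N.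
  by rewrite (exprS y m.+2) (exprS y m.+1) (exprS y m); move: (y ^+ m) => p; ring.
- have -> : - m%:R * flat m.+1 0 + flat m.+2 0 = 0.
    by rewrite /flat ltxx mulr0 addr0.
  by apply: is_derive_quadratic (flat_le m); rewrite /flat ltxx.
Qed.

Lemma Ck_flat (k m : nat) : Ck k (flat m).
Proof.
elim: k m => // k IH m; exists (fun t => - m%:R * flat m.+1 t + flat m.+2 t); split.
  exact: is_derive_flat.
by apply: CkD => //; apply: CkM => //; exact: Ck_cst.
Qed.

Lemma flat0_ge0 (t : R) : 0 <= flat 0 t.
Proof. by rewrite /flat; case: ifP => // _; rewrite mul1r expR_ge0. Qed.

Lemma flat0_gt0 (t : R) : 0 < t -> 0 < flat 0 t.
Proof. by move=> t0; rewrite /flat t0 mul1r expR_gt0. Qed.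

Lemma flat0_le0 (t : R) : t <= 0 -> flat 0 t = 0.
Proof. by rewrite /flat leNgt => /negbTE ->. Qed.

(** The usual transition [f(t) / (f(t) + f(1 - t))]; [1 - t] is written in the affine form of
    [Ck_affine]. *)
Definition smooth_step (t : R) : R := flat 0 t * (flat 0 t + flat 0 (-1 * t + 1))^-1.

Let den_gt0 t : 0 < flat 0 t + flat 0 (-1 * t + 1).
Proof.
have [t0|t0] := ltP 0 t; first by rewrite ltr_pwDl ?flat0_gt0 ?flat0_ge0.
by rewrite ltr_wpDl ?flat0_ge0// flat0_gt0//; lra.
Qed.

Lemma Ck_smooth_step (k : nat) : Ck k smooth_step.
Proof.
apply: CkM; first exact: Ck_flat.
apply: CkV => [t|]; first by rewrite gt_eqF// den_gt0.
by apply: CkD; [exact: Ck_flat|exact/Ck_affine/Ck_flat].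
Qed.

Lemma smooth_step_ge0 (t : R) : 0 <= smooth_step t.
Proof. by rewrite divr_ge0 ?flat0_ge0// ltW// den_gt0. Qed.

Lemma smooth_step_le1 (t : R) : smooth_step t <= 1.
Proof. by rewrite ler_pdivrMr ?den_gt0// mul1r lerDl flat0_ge0. Qed.

Lemma smooth_step0 (t : R) : t <= 0 -> smooth_step t = 0.
Proof. by move=> t0; rewrite /smooth_step flat0_le0// mul0r. Qed.

Lemma smooth_step1 (t : R) : 1 <= t -> smooth_step t = 1.
Proof.
move=> t1; rewrite /smooth_step (@flat0_le0 (-1 * t + 1)) ?addr0; last lra.
by rewrite mulfV// gt_eqF// flat0_gt0//; lra.
Qed.

(** A difference of consecutive steps, so that integer translates telescope to a partition of
    unity. *)
Definition bump (t : R) : R := smooth_step (1 * t + 1) + -1 * smooth_step t.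

Lemma Ck_bump (k : nat) : Ck k bump.
Proof.
apply: CkD; first exact/Ck_affine/Ck_smooth_step.
by apply: CkM; [exact: Ck_cst|exact: Ck_smooth_step].
Qed.

Lemma bump_ge0 (t : R) : 0 <= bump t.
Proof.
rewrite /bump; have [t0|t0] := leP t 0.
  by rewrite (smooth_step0 t0) mulr0 addr0 smooth_step_ge0.
by rewrite smooth_step1; [have := smooth_step_le1 t; lra|lra].
Qed.

Lemma bump_supp (t : R) : bump t != 0 -> `|t| <= 1.
Proof.
apply: contraTT; rewrite -ltNge negbK lter_normr => /orP[t1|t1].
  by rewrite /bump !smooth_step1; [apply/eqP; ring|lra|lra].
by rewrite /bump !smooth_step0; [apply/eqP; ring|lra|lra].
Qed.

Lemma sum_bump (N : nat) (t : R) : `|t| <= N%:R - 1 ->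
  \sum_(j < N + N) bump (t + N%:R - j%:R) = 1.
Proof.
rewrite ler_norml => /andP[h1 h2].
pose F (j : nat) := smooth_step (t + N%:R - j%:R + 1).
have E j : bump (t + N%:R - j%:R) = F j - F j.+1.
  rewrite /bump /F mul1r mulN1r -natr1; congr (_ - smooth_step _); ring.
rewrite (eq_bigr (fun j : 'I_(N + N) => F j - F j.+1)) => [|j _]; last exact: E.
rewrite -(big_mkord xpredT (fun j => F j - F j.+1)).
have -> : \sum_(0 <= j < N + N) (F j - F j.+1) = F 0 - F (N + N)%N.
  elim: (N + N)%N => [|m IH]; first by rewrite big_geq// subrr.
  by rewrite big_nat_recr//= IH; ring.
(* The end arguments are [t + N + 1 >= 1] and [t - N + 1 <= 0]. *)
by rewrite /F smooth_step1 ?smooth_step0 ?subr0// ?natrD; lra.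
Qed.

Lemma Ck_derive1 (g : R -> R) : (forall k, Ck k g) ->
  (forall t, is_derive t (1 : R) g (g^`()%classic t)) /\ (forall k, Ck k (g^`()%classic)).
Proof.
move=> Cg; have E g' : (forall t, is_derive t (1 : R) g (g' t)) -> g^`()%classic = g'.
  by move=> dg; apply/funext => t; rewrite derive1E; have := dg t => h; rewrite derive_val.
have [g' [dg _]] := Cg 1%N; split; first by rewrite (E _ dg).
by move=> k; have [h [dh Ch]] := Cg k.+1; rewrite (E _ dh).
Qed.

End Ck.

(** * Finite sums of products of one-variable functions *)

Section TensorSums.
Context {R : realType}.
Variables (n : nat) (T : finType).
Implicit Types (c : T -> R) (G : T -> 'I_n -> R -> R).

(** A class stable under partial derivatives, each of which differentiates one factor in every
    product; smoothness in [n] variables is thereby reduced to one variable. *)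
Definition tensor_sum c G (x : 'rV[R]_n) : R :=
  \sum_(k : T) c k * \prod_(i < n) G k i (x ord0 i).

Lemma differentiable_bigprod (I : Type) (s : seq I) (P : pred I) (f : I -> 'rV[R]_n -> R) (x : 'rV[R]_n) :
  (forall i, differentiable (f i) x) ->
  differentiable (fun x => \prod_(i <- s | P i) f i x) x.
Proof.
move=> df; elim: s => [|i s IH].
  by rewrite (_ : (fun x => _) = cst 1)//; apply/funext => y; rewrite big_nil.
have [Pi|nPi] := boolP (P i).
  rewrite (_ : (fun x => _) = f i * (fun x => \prod_(i <- s | P i) f i x)).
    exact: differentiableM.
  by apply/funext => y; rewrite big_cons Pi.
rewrite (_ : (fun x => _) = (fun x => \prod_(i <- s | P i) f i x))//.
by apply/funext => y; rewrite big_cons (negbTE nPi).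
Qed.

Lemma differentiable_bigsum (I : Type) (s : seq I) (f : I -> 'rV[R]_n -> R) (x : 'rV[R]_n) :
  (forall i, differentiable (f i) x) ->
  differentiable (fun x => \sum_(i <- s) f i x) x.
Proof.
move=> df; elim: s => [|i s IH].
  by rewrite (_ : (fun x => _) = cst 0)//; apply/funext => y; rewrite big_nil.
rewrite (_ : (fun x => _) = f i + (fun x => \sum_(i <- s) f i x)).
  exact: differentiableD.
by apply/funext => y; rewrite big_cons.
Qed.

Lemma is_derive_bigsum (I : Type) (s : seq I) (f : I -> R -> R) (df : I -> R) (t : R) :
  (forall i, is_derive t (1 : R) (f i) (df i)) ->
  is_derive t (1 : R) (fun t => \sum_(i <- s) f i t) (\sum_(i <- s) df i).
Proof.
move=> dff; elim: s => [|i s IH].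
  rewrite big_nil (_ : (fun x => _) = cst 0); first exact: is_derive_cst.
  by apply/funext => y; rewrite big_nil.
rewrite big_cons (_ : (fun t => _) = f i + (fun x => \sum_(i <- s) f i x)).
  exact: is_deriveD.
by apply/funext => y; rewrite big_cons.
Qed.

Lemma differentiable_tensor_sum c G (x : 'rV[R]_n) : (forall k i m, Ck m (G k i)) ->
  differentiable (tensor_sum c G) x.
Proof.
move=> CG; apply: differentiable_bigsum => k.
apply: (@differentiableM _ _ (cst (c k))); first exact: differentiable_cst.
apply: differentiable_bigprod => i.
apply: (@differentiable_comp _ _ _ _ (fun x : 'rV[R]_n => x ord0 i) (G k i)).
  exact: differentiable_coord.
have [g' [dg _]] := CG k i 1%N.
by apply/derivable1_diffP; case: (dg (x ord0 i)).
Qed.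

Lemma partial_tensor_sum c G (j : 'I_n) : (forall k i m, Ck m (G k i)) ->
  partial j (tensor_sum c G) =
  tensor_sum c (fun k i => if i == j then (G k i)^`()%classic else G k i).
Proof.
move=> CG; apply/funext => x.
have h : is_derive (0 : R) (1 : R) (fun t => tensor_sum c G (x + t *: basis_vec R j))
    (partial j (tensor_sum c G) x).
  have := partial_line j x 0 (fun x => differentiable_tensor_sum c x CG).
  by rewrite scale0r addr0.
rewrite -(@derive_val _ _ _ _ _ _ _ h).
(* Along the line in direction [j] only the factor of index [j] varies; the others join the
   coefficient. *)
have -> : (fun t => tensor_sum c G (x + t *: basis_vec R j)) = (fun t =>
    \sum_(k : T) (c k * \prod_(i < n | i != j) G k i (x ord0 i)) *
      G k j (1 * t + x ord0 j)).
  apply/funext => t; apply: eq_bigr => k _; rewrite (bigD1 j)//= !mxE eqxx mulr1.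
  rewrite mul1r (addrC t) -mulrA; congr (_ * _); rewrite mulrC; congr (_ * _).
  by apply: eq_bigr => i ij; rewrite !mxE (negbTE ij) mulr0 addr0.
have h2 : is_derive (0 : R) (1 : R) (fun t =>
    \sum_(k : T) (c k * \prod_(i < n | i != j) G k i (x ord0 i)) *
      G k j (1 * t + x ord0 j))
    (\sum_(k : T) (c k * \prod_(i < n | i != j) G k i (x ord0 i)) *
      (G k j)^`()%classic (x ord0 j)).
  apply: is_derive_bigsum => k.
  have [dG _] := Ck_derive1 (CG k j).
  have hA : is_derive (0 : R) (1 : R) (fun t => 1 * t + x ord0 j) 1.
    by apply: is_derive_eq; rewrite /GRing.scale /=; ring.
  have := @is_derive1_comp R (G k j) (fun t => 1 * t + x ord0 j) 0 _ _ (dG _) hA.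
  by rewrite mulr0 add0r mulr1 => hG; exact: is_deriveZ.
rewrite (@derive_val _ _ _ _ _ _ _ h2); apply: eq_bigr => k _.
rewrite [in RHS](bigD1 j)//= eqxx -mulrA; congr (_ * _); rewrite mulrC; congr (_ * _).
by apply: eq_bigr => i /negbTE ->.
Qed.

Lemma smooth_tensor_sum c G : (forall k i m, Ck m (G k i)) -> smooth (tensor_sum c G).
Proof.
move=> CG l x.
have [G' [CG' ->]] : exists G', (forall k i m, Ck m (G' k i)) /\
    iter_partial l (tensor_sum c G) = tensor_sum c G'.
  elim: l => [|j l [G' [CG' /= ->]]]; first by exists G.
  rewrite (partial_tensor_sum _ _ CG'); eexists; split; last by [].
  move=> k i m /=; case: ifP => _ //.
  by have [_ H] := Ck_derive1 (CG' k i); exact: H.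
exact: differentiable_tensor_sum.
Qed.

End TensorSums.

(** Sample [psi] on a grid of mesh [h] and interpolate with the partition of unity made of products
    of bumps. Only grid points within [h] of [x] contribute at [x], so the modulus of continuity of
    [psi] controls the error, and the weights stay nonnegative. *)
Lemma smooth_approximation (R : realType) (n : nat) (psi : 'rV[R]_n -> R) (eps eta : R) :
  cc psi -> (forall x, 0 <= psi x) -> 0 < eps -> 0 < eta ->
  exists phi : 'rV[R]_n -> R, [/\ smooth phi, forall x, 0 <= phi x,
    forall x, `|phi x - psi x| <= eps &
    forall x, phi x != 0 -> exists2 y, `|x - y| <= eta & psi y != 0].
Proof.
move=> cpsi psi0 eps0 eta0.
have [delta delta0 Hd] := cc_unif cpsi eps0.
have [_ [M psiM]] := cpsi.
(* [h < delta] bounds the error, [h <= eta] the growth of the support. *)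
pose h := Num.min (delta / 2) eta.
have h0 : 0 < h by rewrite lt_min divr_gt0.
have hd : h < delta by rewrite gt_min ltr_pdivrMr// ltr_pMr// ltr1n.
have heta : h <= eta by rewrite ge_min lexx orbT.
(* The grid is taken large enough for the bumps to sum to 1 on a ball of radius at least
   [|M| + h]. *)
pose N := (Num.truncn ((`|M| + h) / h + 1)).+1.
have hN : (`|M| + h) / h + 1 < N%:R.
  by apply: truncnS_gt.
have hN1 : `|M| + h <= h * (N%:R - 1) by rewrite -ler_pdivrMl// mulrC; lra.
pose pt (k : {ffun 'I_n -> 'I_(N + N)}) : 'rV[R]_n := \row_i (h * ((k i)%:R - N%:R)).
pose G (k : {ffun 'I_n -> 'I_(N + N)}) (i : 'I_n) (t : R) : R :=
  bump (h^-1 * t + (N%:R - (k i)%:R)).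
pose P k (x : 'rV[R]_n) := \prod_(i < n) G k i (x ord0 i).
have P0 k x : 0 <= P k x by apply: prodr_ge0 => i _; exact: bump_ge0.
have Psupp k x : P k x != 0 -> `|x - pt k| <= h.
  move=> /prodf_neq0 H; apply: rV_norm_le (ltW h0) _ => i.
  have /bump_supp := H i isT; rewrite !mxE.
  have -> : x ord0 i - h * ((k i)%:R - N%:R) =
      h * (h^-1 * x ord0 i + (N%:R - (k i)%:R)) by field; rewrite gt_eqF.
  by rewrite normrM (gtr0_norm h0) => hb; rewrite ger_pMr.
have P1 x : `|x| <= h * (N%:R - 1) -> \sum_k P k x = 1.
  (* The sum over multi-indices factors into one-dimensional sums, each equal to 1 by [sum_bump]. *)
  move=> xN; rewrite /P -(bigA_distr_bigA (fun (i : 'I_n) (j : 'I_(N + N)) =>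
    bump (h^-1 * x ord0 i + (N%:R - j%:R)))).
  rewrite big1// => i _; rewrite -[RHS](@sum_bump _ N (h^-1 * x ord0 i)).
    by apply: eq_bigr => j _; rewrite addrA.
  rewrite normrM gtr0_norm ?invr_gt0// ler_pdivrMl//.
  exact: le_trans (rV_coord_le _ _) xN.
exists (tensor_sum (fun k => psi (pt k)) G); split.
- by apply: smooth_tensor_sum => k i m; exact/Ck_affine/Ck_bump.
- by move=> x; apply: sumr_ge0 => k _; rewrite mulr_ge0//; exact: P0.
- move=> x; have [xN|Nx] := leP `|x| (h * (N%:R - 1)).
    have E c : c = \sum_k c * P k x by rewrite -mulr_sumr P1// mulr1.
    rewrite [psi x in X in X <= _]E -sumrB; apply: le_trans (ler_norm_sum _ _ _) _.
    rewrite [leRHS]E; apply: ler_sum => k _.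
    rewrite -/(P k x) -mulrBl normrM (ger0_norm (P0 k x)).
    have [->|/Psupp xk] := eqVneq (P k x) 0; first by rewrite !mulr0.
    by rewrite ler_wpM2r// ltW// distrC Hd// (le_lt_trans xk).
  (* Beyond the region where the bumps sum to 1, [psi] vanishes at [x] and at every grid point
     within [h] of [x]. *)
  rewrite psiM; last by have := ler_norm M; lra.
  rewrite subr0 /tensor_sum big1 ?normr0 ?ltW// => k _.
  have [->|/Psupp xk] := eqVneq (\prod_(i < n) G k i (x ord0 i)) 0; first by rewrite mulr0.
  rewrite psiM ?mul0r//; have := ler_norm M; have := lerB_dist x (x - pt k).
  by rewrite opprB (addrC x (pt k - x)) subrK => ? ?; lra.
- move=> x; have [[k Hk _]|H] := pselect (exists2 k, psi (pt k) * P k x != 0 & True).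
    move: Hk; rewrite mulf_eq0 negb_or => /andP[pk /Psupp xk] _.
    by exists (pt k) => //; exact: le_trans heta.
  rewrite /tensor_sum big1 ?eqxx// => k _; apply/eqP/negP => /negP kk; apply: H.
  by exists k.
Qed.

(** * Second differences of the distance *)

Section PointwiseEstimate.
Context {R : realType}.

(** Here [p], [w], [g] stand for the increments of [d], [|u|] and the weight, [a] for the gradient
    of [u], [G] and [phi] for the weight and [|u|], [A] for [(s - 1) d^(-s)], and [E] for the bound
    by second differences. The increment of a product splits into three sums: the first yields the
    gradient term, the second the term in [A], the third is of order [r^3]. *)
Lemma pointwise_estimate (n : nat) (e p w g E a : 'I_n -> R)
    (r G phi A L C1 CG Cphi CA LG B : R) :
  0 <= r -> 0 <= L -> 0 <= C1 -> 0 <= LG -> 0 <= B ->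
  \sum_i e i ^+ 2 = 1 ->
  (forall i, `|r * e i - p i| <= E i) -> (forall i, `|p i| <= r) ->
  (forall i, `|w i| <= L * r) -> (forall i, `|w i| <= r * `|a i| + C1 * r ^+ 2) ->
  0 <= G <= CG -> 0 <= phi <= Cphi -> 0 <= A <= CA ->
  (forall i, p i * g i <= - A * p i ^+ 2 + B * r ^+ 3) ->
  (forall i, `|g i| <= LG * r) ->
  \sum_i (w i * G + phi * g i + w i * g i) * p i <=
    r ^+ 2 * (G * Num.sqrt (\sum_i a i ^+ 2) - A * phi) +
    (CG * n%:R * C1 + Cphi * n%:R * B + n%:R * L * LG) * r ^+ 3 +
    (CG * L + 2 * CA * Cphi) * r * \sum_i E i.
Proof.
move=> r0 L0 C10 LG0 B0 e1 hE hp hw hwa /andP[G0 GC] /andP[f0 fC] /andP[A0 AC] hpg hg.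
have E0 i : 0 <= E i by exact: le_trans (hE i).
set X := \sum_i E i; have X0 : 0 <= X by exact: sumr_ge0.
set Na := Num.sqrt _; have Na0 : 0 <= Na by exact: sqrtr_ge0.
have ei i : `|e i| <= 1.
  rewrite -(ler_pXn2r (n := 2))// ?nnegrE// real_normK ?num_real// expr1n -e1.
  by rewrite (bigD1 i)//= lerDl sumr_ge0// => j _; exact: sqr_ge0.
have r20 : 0 <= r ^+ 2 by exact: sqr_ge0.
have r30 : 0 <= r ^+ 3 by exact: exprn_ge0.
have CSea : \sum_i `|e i| * `|a i| <= Na.
  have := cauchy_schwarz (\row_i `|e i|) (\row_i `|a i|).
  have -> : enorm (\row_i `|e i|) = 1.
    rewrite /enorm (eq_bigr (fun i => e i ^+ 2)) ?e1 ?sqrtr1// => i _.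
    by rewrite mxE real_normK ?num_real.
  have -> : enorm (\row_i `|a i|) = Na.
    by congr Num.sqrt; apply: eq_bigr => i _; rewrite mxE real_normK ?num_real.
  by rewrite mul1r (eq_bigr (fun i => `|e i| * `|a i|))// => i _; rewrite !mxE.
have sumc (c : R) : \sum_(i < n) c = n%:R * c by rewrite sumr_const card_ord mulr_natl.
(* Replace [p i] by [r * e i] at the cost [E i]; Cauchy-Schwarz with the unit vector [e] then
   produces the norm of the gradient. *)
have T1 : \sum_i w i * p i <= r ^+ 2 * Na + n%:R * C1 * r ^+ 3 + L * r * X.
  apply: (@le_trans _ _ (\sum_i (r ^+ 2 * (`|e i| * `|a i|) + C1 * r ^+ 3 + L * r * E i))).
    apply: ler_sum => i _.
    have -> : w i * p i = r * (e i * w i) - w i * (r * e i - p i) by ring.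
    have h1 : e i * w i <= `|e i| * `|w i| by rewrite -normrM ler_norm.
    have h2 : `|e i| * `|w i| <= `|e i| * (r * `|a i| + C1 * r ^+ 2) by rewrite ler_wpM2l.
    have h3 : `|e i| * (C1 * r ^+ 2) <= 1 * (C1 * r ^+ 2).
      by rewrite ler_wpM2r// mulr_ge0.
    have h4 : - (w i * (r * e i - p i)) <= L * r * E i.
      apply: le_trans (ler_norm _) _; rewrite normrN normrM.
      by apply: ler_pM => //; exact: hw.
    have h5 : r * (e i * w i) <= r * (`|e i| * (r * `|a i|) + 1 * (C1 * r ^+ 2)).
      by rewrite ler_wpM2l//; lra.
    have -> : r ^+ 2 * (`|e i| * `|a i|) + C1 * r ^+ 3 + L * r * E i =
      r * (`|e i| * (r * `|a i|) + 1 * (C1 * r ^+ 2)) + L * r * E i by ring.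
    by apply: lerD.
  rewrite !big_split/= -!mulr_sumr sumc -/X.
  have : r ^+ 2 * \sum_i `|e i| * `|a i| <= r ^+ 2 * Na by rewrite ler_wpM2l.
  by lra.
(* The discrete form of [|grad d| = 1]: write [p = r e - h], drop the squares of [h], and use that
   each [|e i|] is at most 1. *)
have T2 : r ^+ 2 - 2 * r * X <= \sum_i p i ^+ 2.
  apply: (@le_trans _ _ (\sum_i (r ^+ 2 * e i ^+ 2 - 2 * r * E i))).
    by rewrite sumrB -!mulr_sumr e1 mulr1.
  apply: ler_sum => i _; set h := r * e i - p i.
  have -> : p i ^+ 2 = r ^+ 2 * e i ^+ 2 - 2 * r * (e i * h) + h ^+ 2.
    by rewrite /h; ring.
  have : e i * h <= 1 * E i.
    by apply: le_trans (ler_norm _) _; rewrite normrM ler_pM//; exact: hE.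
  rewrite mul1r => eh; have := sqr_ge0 h.
  have : r * (e i * h) <= r * E i by rewrite ler_wpM2l.
  by lra.
have T3 : \sum_i p i * g i <= - A * r ^+ 2 + 2 * A * (r * X) + n%:R * B * r ^+ 3.
  apply: (@le_trans _ _ (\sum_i (- A * p i ^+ 2 + B * r ^+ 3))).
    by apply: ler_sum => i _; exact: hpg.
  rewrite big_split/= -mulr_sumr sumc.
  have : A * (r ^+ 2 - 2 * r * X) <= A * \sum_i p i ^+ 2 by rewrite ler_wpM2l.
  by lra.
have T4 : \sum_i w i * g i * p i <= n%:R * L * LG * r ^+ 3.
  rewrite -2!mulrA -sumc; apply: ler_sum => i _.
  apply: le_trans (ler_norm _) _; rewrite !normrM.
  have -> : L * (LG * r ^+ 3) = (L * r) * (LG * r) * r by ring.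
  by rewrite ler_pM// ler_pM.
have -> : \sum_i (w i * G + phi * g i + w i * g i) * p i =
    G * (\sum_i w i * p i) + phi * (\sum_i p i * g i) + \sum_i w i * g i * p i.
  by rewrite !mulr_sumr -!big_split/=; apply: eq_bigr => i _; ring.
have P1 : G * (\sum_i w i * p i) <= G * (r ^+ 2 * Na + n%:R * C1 * r ^+ 3 + L * r * X).
  by rewrite ler_wpM2l.
have P1' : G * (n%:R * C1 * r ^+ 3 + L * r * X) <= CG * (n%:R * C1 * r ^+ 3 + L * r * X).
  by rewrite ler_wpM2r// addr_ge0// !mulr_ge0.
have P2 : phi * (\sum_i p i * g i) <=
    phi * (- A * r ^+ 2 + 2 * A * (r * X) + n%:R * B * r ^+ 3) by rewrite ler_wpM2l.
have P2' : phi * (n%:R * B * r ^+ 3) <= Cphi * (n%:R * B * r ^+ 3).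
  by rewrite ler_wpM2r// !mulr_ge0.
have P3 : phi * A * (r * X) <= Cphi * CA * (r * X).
  by rewrite ler_wpM2r ?mulr_ge0// ler_pM.
lra.
Qed.

End PointwiseEstimate.

(** * Second differences of the distance against smooth test functions *)

Section WeakSuperharmonic.
Context {R : realType}.
Variables (n : nat) (Omega : set 'rV[R]_n).
Local Notation d := (dist_compl Omega).
Hypothesis nT : exists y, ~ Omega y.
Hypothesis dsuper : neg_laplacian_nonneg_distr Omega d.

Definition second_diff (r : R) (i : 'I_n) (x : 'rV[R]_n) : R :=
  2 * d x - d (x + r *: basis_vec R i) - d (x - r *: basis_vec R i).

Let cd : continuous d := dist_compl_continuous nT.

(** By symmetry the second difference falls on [phi], where Taylor's formula makes it [- r^2] times
    the second derivative up to [O(r^3)]; the hypothesis makes the integral of [d * laplacian phi]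
    nonpositive. *)
Lemma sum_second_diff_test (phi : 'rV[R]_n -> R) : test_fun Omega phi ->
  (forall x, 0 <= phi x) ->
  exists2 C, 0 <= C & forall r, 0 < r -> r <= 1 ->
    - C * r ^+ 3 <= \sum_i integral_Rn (fun x => phi x * second_diff r i x).
Proof.
move=> tphi phi0; have [sphi cpt supp] := tphi.
have cphi : continuous phi by move=> x; exact/differentiable_continuous/(sphi [::]).
have ccphi : cc phi by exact: compact_support_cc.
have d1 i x : differentiable (partial i phi) x by exact: (sphi [:: i]).
have d2 i x : differentiable (partial i (partial i phi)) x by exact: (sphi [:: i; i]).
have cc2 i : cc (partial i (partial i phi)) by exact: (smooth_cc [:: i; i]).
have [C3 C30 H3] : exists2 C, 0 <= C & forall i x,
    `|partial i (partial i (partial i phi)) x| <= C.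
  exact: cc_family_bounded (fun i => smooth_cc [:: i; i; i] sphi ccphi).
have [_ [M phiM]] := ccphi.
(* Radius [M + 1], since the translates of [phi] by [r <= 1] may reach beyond [M]. *)
have [chi cchi [chi0 chi1]] := cc_cutoff n (M + 1).
have cclap : cc (fun x => d x * laplacian phi x).
  by apply: ccMl => //; exact: cc_sum.
have ccdchi : cc (fun x => d x * chi x) by exact: ccMl.
exists (n%:R * (2 * C3) * integral_Rn (fun x => d x * chi x)).
  rewrite mulr_ge0 ?mulr_ge0//; apply: intR_ge0 => // x.
  by rewrite mulr_ge0// dist_compl_ge0.
move=> r r0 r1.
(* The Laplacian of [phi] vanishes off [Omega], so the integral over [Omega] is one over the whole
   space. *)
have Hneg : integral_Rn (fun x => d x * laplacian phi x) <= 0.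
  have := dsuper tphi phi0; rewrite oppr_ge0 /integral_over.
  rewrite (_ : (fun x => if _ then _ else _) = (fun x => d x * laplacian phi x))//.
  apply/funext => x; case: asboolP => // nOx.
  rewrite /laplacian big1 ?mulr0// => i _; apply: partial_vanish.
  by apply: partial_off_closure => /supp.
pose z i : 'rV[R]_n := r *: basis_vec R i.
pose D i x := 2 * phi x - phi (x + z i) - phi (x - z i).
have ccD2 i : cc (D i).
  by apply: ccB; [apply: ccB; [exact: ccZ|exact: cc_shift]|exact: cc_shift].
have -> : \sum_i integral_Rn (fun x => phi x * second_diff r i x) =
    integral_Rn (fun x => \sum_i d x * D i x).
  rewrite intR_sum => [|i]; last exact: ccMl.
  by apply: eq_bigr => i _; exact: intR_second_diff_sym.
apply: (@le_trans _ _ (integral_Rn (fun x => - r ^+ 2 * (d x * laplacian phi x) -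
    n%:R * (2 * C3) * r ^+ 3 * (d x * chi x)))).
  rewrite intRB; [|exact: ccZ|exact: ccZ]; rewrite !intRZ//.
  have : 0 <= - r ^+ 2 * integral_Rn (fun x => d x * laplacian phi x).
    by rewrite mulr_le0// oppr_le0 sqr_ge0.
  lra.
apply: le_intR; first by apply: ccB; exact: ccZ.
  by apply: cc_sum => i; exact: ccMl.
move=> x; have dx := dist_compl_ge0 nT x.
have Cr0 : 0 <= 2 * C3 * r ^+ 3 by apply: mulr_ge0; [exact: mulr_ge0|exact/exprn_ge0/ltW].
have key i : - r ^+ 2 * partial i (partial i phi) x - 2 * C3 * r ^+ 3 * chi x <= D i x.
  have [xM|Mx] := leP `|x| (M + 1).
    have := taylor3 x (sphi [::]) (d1 i) (d2 i) (ltW r0) (H3 i).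
    rewrite -/(D i x) ler_norml => /andP[h _].
    have : 2 * C3 * r ^+ 3 * 1 <= 2 * C3 * r ^+ 3 * chi x.
      by rewrite ler_wpM2l ?chi1.
    by move: h; rewrite /D /z; lra.
  have Mx' : M < `|x| by lra.
  have -> : partial i (partial i phi) x = 0.
    have : \forall y \near x, M < `|y| by have /cvgr_gt := @norm_continuous R _ x; apply.
    rewrite -nbhs_nearE => near_x; apply: partial_vanish; move: near_x.
    move=> /nbhs_interior; apply: filterS => y /= ny; apply: partial_vanish.
    by apply: filterS ny => y' /phiM.
  have zr : `|z i| <= r.
    by rewrite (le_trans (norm_le_enorm _))// enorm_basis gtr0_norm.
  have -> : D i x = 0.
    rewrite /D !phiM ?mulr0 ?subr0//.
    - by have := lerB_dist x (z i); lra.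
    - by have := lerB_normD x (z i); lra.
  by rewrite mulr0 sub0r oppr_le0 mulr_ge0.
have : d x * \sum_i (- r ^+ 2 * partial i (partial i phi) x - 2 * C3 * r ^+ 3 * chi x)
    <= d x * \sum_i D i x by rewrite ler_wpM2l// ler_sum.
have -> : \sum_i (- r ^+ 2 * partial i (partial i phi) x - 2 * C3 * r ^+ 3 * chi x) =
    - r ^+ 2 * laplacian phi x - n%:R * (2 * C3 * r ^+ 3 * chi x).
  by rewrite sumrB -mulr_sumr sumr_const card_ord [in RHS]mulr_natl.
move=> h; rewrite -[leRHS]mulr_sumr; apply: le_trans h.
move: (d x) (laplacian phi x) (chi x) => dx' l c.
by rewrite le_eqVlt; apply/orP; left; apply/eqP; ring.
Qed.

End WeakSuperharmonic.

(** * Mass bounds near a bounded set inside the domain, and continuous test functions *)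

Section Cutoff.
Context {R : realType}.
Variables (n : nat) (Omega S : set 'rV[R]_n) (rho M : R).
Local Notation d := (dist_compl Omega).
Hypothesis nT : exists y, ~ Omega y.
Hypothesis rho0 : 0 < rho.
Hypothesis S0 : exists y, S y.
Hypothesis SM : forall x, S x -> `|x| <= M.
Hypothesis Sd : forall x, S x -> 4 * rho <= d x.

Definition dist_set (x : 'rV[R]_n) : R := dist_compl (~` S) x.

(** At least 1 on the [rho]-neighbourhood of [S] and zero from distance [2 * rho] on. The margin
    [4 * rho] in the hypothesis on [S] keeps [d] above [2 * rho] wherever the cutoff is nonzero. *)
Definition cutoff (x : 'rV[R]_n) : R := Num.max 0 (2 - dist_set x / rho).

(* Dominates [`|second_diff Omega r i|] where [rho <= d], and integrates to [O(r^2)]. *)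
Definition second_diff_dom (r : R) (i : 'I_n) (x : 'rV[R]_n) : R :=
  second_diff Omega r i x + 6 * ((1 / (2 * rho) + 1) * r ^+ 2).

Let nTS : exists y, ~ (~` S) y.
Proof. by case: S0 => y Sy; exists y => /(_ Sy). Qed.

Let cd : continuous d := dist_compl_continuous nT.

Lemma continuous_second_diff (r : R) (i : 'I_n) : continuous (second_diff Omega r i).
Proof.
apply: (@continuous_funB _ _ (fun x => 2 * d x - d (x + r *: basis_vec R i))
  (fun x => d (x - r *: basis_vec R i))); last exact: continuous_shiftr cd.
apply: (@continuous_funB _ _ (fun x => 2 * d x) (fun x => d (x + r *: basis_vec R i)));
  last exact: continuous_shiftr cd.
exact: (continuous_funM (@continuous_fun_cst _ _ 2) cd).
Qed.

Lemma continuous_second_diff_dom (r : R) (i : 'I_n) :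
  continuous (second_diff_dom r i).
Proof.
rewrite (_ : second_diff_dom r i = fun x =>
    second_diff Omega r i x - - (6 * ((1 / (2 * rho) + 1) * r ^+ 2))).
  exact: continuous_funB (@continuous_second_diff r i) (@continuous_fun_cst R n _).
by apply/funext => x; rewrite opprK.
Qed.

Lemma dist_set_mem (x : 'rV[R]_n) : S x -> dist_set x <= 0.
Proof. by move=> Sx; apply: dist_compl_out => /(_ Sx). Qed.

Lemma dist_set_le (x y : 'rV[R]_n) : S y -> dist_set x <= enorm (x - y).
Proof. by move=> Sy; apply: dist_compl_le => /(_ Sy). Qed.

Lemma dist_set_ge (x : 'rV[R]_n) (C : R) :
  (forall y, S y -> C <= enorm (x - y)) -> C <= dist_set x.
Proof. by move=> H; apply: dist_compl_ge => // y /contrapT; exact: H. Qed.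

Lemma dist_set_dist (x : 'rV[R]_n) : 4 * rho - dist_set x <= d x.
Proof.
suff : 4 * rho - d x <= dist_set x by lra.
apply: dist_set_ge => y Sy; have := Sd Sy; have := dist_compl_lip1 nT y x.
by rewrite -(enormN (y - x)) opprB => ? ?; lra.
Qed.

Lemma dist_set_norm (x : 'rV[R]_n) : `|x| - M <= dist_set x.
Proof.
apply: dist_set_ge => y Sy; apply: le_trans (norm_le_enorm _).
by have := SM Sy; have := lerB_dist x y; lra.
Qed.

Lemma continuous_dist_set : continuous dist_set.
Proof. exact: dist_compl_continuous. Qed.

Lemma cutoff_ge0 (x : 'rV[R]_n) : 0 <= cutoff x.
Proof. by rewrite le_max lexx. Qed.

Lemma cutoff_ge1 (x : 'rV[R]_n) : dist_set x <= rho -> 1 <= cutoff x.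
Proof.
move=> h; rewrite le_max; apply/orP; right.
by have : dist_set x / rho <= 1 by [rewrite ler_pdivrMr// mul1r]; lra.
Qed.

Lemma cutoff_eq0 (x : 'rV[R]_n) : 2 * rho <= dist_set x -> cutoff x = 0.
Proof.
move=> h; apply/max_idPl.
by have : 2 <= dist_set x / rho by [rewrite ler_pdivlMr]; lra.
Qed.

Lemma cutoff_lip (x y : 'rV[R]_n) : `|cutoff x - cutoff y| <= rho^-1 * enorm (x - y).
Proof.
have H a b : cutoff a - cutoff b <= rho^-1 * enorm (a - b).
  have h : dist_set b / rho - dist_set a / rho <= rho^-1 * enorm (a - b).
    rewrite -mulrBl mulrC ler_pM2l ?invr_gt0// -(enormN (a - b)) opprB.
    exact: dist_compl_lip1.
  have h0 : 0 <= rho^-1 * enorm (a - b) by rewrite mulr_ge0 ?enorm_ge0// invr_ge0 ltW.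
  have hb : 2 - dist_set b / rho <= cutoff b by rewrite le_max lexx orbT.
  have hb0 := cutoff_ge0 b.
  have [h1|/ltW h1] := leP (2 - dist_set a / rho) 0.
    have -> : cutoff a = 0 by exact/max_idPl.
    by lra.
  have -> : cutoff a = 2 - dist_set a / rho by exact/max_idPr.
  by lra.
rewrite ler_norml; have h1 := H x y; have h2 := H y x.
rewrite -(enormN (y - x)) opprB in h2.
by apply/andP; split; lra.
Qed.

Lemma cc_cutoff_set : cc cutoff.
Proof.
split; first exact: lip_continuous cutoff_lip.
exists (M + 2 * rho) => x xM; apply: cutoff_eq0.
by have := dist_set_norm x; lra.
Qed.

(** In [dist_compl_directions] a nonnegative quantity is at most the second difference plus [3 X],
    with [X] the error unit. So the second difference is at least [- 3 X], and adding [6 X]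
    dominates its absolute value. *)
Lemma second_diff_le (r : R) (i : 'I_n) (x : 'rV[R]_n) : 0 < r -> rho <= d x ->
  `|second_diff Omega r i x| <= second_diff_dom r i x.
Proof.
move=> r0 dx; have [e [_ /(_ i _ erefl) He]] := dist_compl_directions nT rho0 dx r0.
move: He; rewrite /second_diff_dom -/(second_diff Omega r i x); set C := _ * r ^+ 2 => He.
have C0 : 0 <= C.
  by rewrite mulr_ge0 ?sqr_ge0// addr_ge0// divr_ge0// mulr_ge0// ltW.
have := le_trans (normr_ge0 _) He; rewrite ler_norml => h.
by apply/andP; split; lra.
Qed.

Lemma cutoff_second_diff_dom_ge0 (r : R) (i : 'I_n) (x : 'rV[R]_n) : 0 < r ->
  0 <= cutoff x * second_diff_dom r i x.
Proof.
move=> r0; have [h|h] := leP (2 * rho) (dist_set x); first by rewrite cutoff_eq0// mul0r.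
rewrite mulr_ge0 ?cutoff_ge0//; apply: le_trans (normr_ge0 _) (second_diff_le i r0 _).
by have := dist_set_dist x; have := rho0; lra.
Qed.

Lemma cc_cutoff_bound (r : R) (i : 'I_n) :
  cc (fun x => cutoff x * second_diff_dom r i x).
Proof. exact: ccMr cc_cutoff_set (@continuous_second_diff_dom r i). Qed.

(* Summing by parts moves one difference from [d] onto the Lipschitz cutoff. *)
Lemma int_cutoff_bound : exists2 C, 0 <= C & forall r, 0 < r -> r <= 1 ->
  \sum_i integral_Rn (fun x => cutoff x * second_diff_dom r i x) <= C * r ^+ 2.
Proof.
have [chi cchi [chi0 chi1]] := cc_cutoff n (M + 2 * rho + 1).
have cX := cc_cutoff_set.
have IX0 : 0 <= integral_Rn cutoff by apply: intR_ge0 => //; exact: cutoff_ge0.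
have Ichi0 : 0 <= integral_Rn chi by exact: intR_ge0.
have K0 : 0 <= 1 / (2 * rho) + 1 by rewrite addr_ge0// divr_ge0// mulr_ge0// ltW.
set K := 1 / (2 * rho) + 1 in K0.
have rV0 : 0 <= rho^-1 by rewrite invr_ge0 ltW.
exists (n%:R * (rho^-1 * integral_Rn chi + 6 * K * integral_Rn cutoff)).
  by rewrite mulr_ge0// addr_ge0 ?mulr_ge0.
move=> r r0 r1.
have -> : n%:R * (rho^-1 * integral_Rn chi + 6 * K * integral_Rn cutoff) * r ^+ 2 =
    \sum_(i < n) (rho^-1 * integral_Rn chi + 6 * K * integral_Rn cutoff) * r ^+ 2.
  by rewrite sumr_const card_ord -mulrA mulr_natl.
apply: ler_sum => i _.
have -> : (fun x => cutoff x * second_diff_dom r i x) =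
    (fun x => cutoff x * second_diff Omega r i x + 6 * K * r ^+ 2 * cutoff x).
  by apply/funext => x; rewrite /second_diff_dom -/K; move: (second_diff Omega r i x) => y; ring.
have c1 : cc (fun x => cutoff x * second_diff Omega r i x).
  exact: ccMr cX (@continuous_second_diff r i).
rewrite intRD//; last exact: ccZ.
rewrite intRZ// intR_second_diff//.
set z := r *: basis_vec R i.
have zr : enorm z = r by rewrite enorm_basis gtr0_norm.
have -> : (rho^-1 * integral_Rn chi + 6 * K * integral_Rn cutoff) * r ^+ 2 =
  rho^-1 * r ^+ 2 * integral_Rn chi + 6 * K * r ^+ 2 * integral_Rn cutoff by ring.
rewrite lerD2r -intRZ//; apply: le_intR.
- apply: ccMr; first by apply: ccB => //; exact: cc_shift.
  apply: continuous_funB => //; exact: continuous_shiftr cd.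
- exact: ccZ.
move=> x /=; have [xM|Mx] := leP `|x| (M + 2 * rho + 1); last first.
  have zr' : `|z| <= r by rewrite -zr norm_le_enorm.
  have -> : cutoff x = 0 by apply: cutoff_eq0; have := dist_set_norm x; lra.
  have -> : cutoff (x + z) = 0.
    apply: cutoff_eq0; have := dist_set_norm (x + z); have := lerB_normD x z; lra.
  by rewrite subrr mul0r mulr_ge0// mulr_ge0// sqr_ge0.
(* One factor [r / rho] comes from the cutoff and one factor [r] from [d], both being Lipschitz. *)
apply: (@le_trans _ _ (rho^-1 * r ^+ 2 * 1)); last first.
  by rewrite ler_wpM2l ?chi1// mulr_ge0// sqr_ge0.
apply: le_trans (ler_norm _) _; rewrite normrM mulr1 expr2 mulrA.
have hx : x + z - x = z by rewrite addrC addKr.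
apply: ler_pM => //.
  by have := cutoff_lip (x + z) x; rewrite hx zr.
by have := dist_compl_lip nT (x + z) x; rewrite hx zr.
Qed.

Hypothesis dsuper : neg_laplacian_nonneg_distr Omega d.

(** Replacing [psi] by a smooth [phi] within [eps'] costs at most [eps'] times the mass bounded in
    [int_cutoff_bound], and the [O(r^3)] loss for [phi] is absorbed by taking [r] small. Each loss
    gets half of [eps]. *)
Lemma int_second_diff_ge (psi : 'rV[R]_n -> R) (eps : R) :
  cc psi -> (forall x, 0 <= psi x) -> (forall x, psi x != 0 -> S x) -> 0 < eps ->
  exists2 r0, 0 < r0 & forall r, 0 < r -> r < r0 -> r <= 1 ->
    - eps * r ^+ 2 <= \sum_i integral_Rn (fun x => psi x * second_diff Omega r i x).
Proof.
move=> cpsi psi0 psiS eps0; have [C C0 HC] := int_cutoff_bound.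
pose eps' := eps / (2 * (C + 1)).
have eps'0 : 0 < eps' by rewrite divr_gt0// mulr_gt0// ltr_wpDl.
have eps'C : eps' * C <= eps / 2.
  by rewrite /eps' mulrAC ler_pdivrMr ?mulr_gt0 ?ltr_wpDl//; nra.
(* The approximation spreads supports by [eta] in the sup norm, hence by at most [n * eta <= rho] in
   the Euclidean norm. *)
pose eta := rho / (n%:R + 1).
have eta0 : 0 < eta by rewrite divr_gt0// ltr_wpDl.
have etan : n%:R * eta <= rho.
  by rewrite /eta mulrA ler_pdivrMr ?ltr_wpDl// mulrC ler_pM2l// lerDl.
have [phi [sphi phi0 phipsi phisupp]] := smooth_approximation cpsi psi0 eps'0 eta0.
have phiS x : phi x != 0 -> dist_set x <= rho.
  move=> /phisupp[y xy /psiS Sy]; apply: le_trans (dist_set_le x Sy) _.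
  by apply: le_trans (enorm_le_norm _) _; apply: le_trans etan; rewrite ler_wpM2l.
have closed_nbd : closed [set x | dist_set x <= rho].
  apply: (@closed_comp _ _ dist_set [set t | t <= rho]); last exact: closed_le.
  by move=> x _; exact: continuous_dist_set.
have clS : closure [set x | phi x != 0] `<=` [set x | dist_set x <= rho].
  by rewrite ((closure_id _).1 closed_nbd); apply: closure_subset => x /phiS.
have tphi : test_fun Omega phi.
  split=> //.
    apply: (subclosed_compact _ (@ball_rV_compact R n (M + rho))).
      exact: closed_closure.
    by move=> x /clS /= h; have := dist_set_norm x; lra.
  move=> x /clS /= h; apply: contrapT => nOx.
  by have := dist_set_dist x; have := dist_compl_out nOx; have := rho0; lra.
have cphi : cc phi.
  apply: compact_support_cc; last by case: tphi.
  by move=> x; exact/differentiable_continuous/(sphi [::]).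
have [C1 C10 HC1] := sum_second_diff_test nT dsuper tphi phi0.
(* This threshold makes [C1 * r <= eps / 2]. *)
exists (eps / (2 * (C1 + 1))); first by rewrite divr_gt0// mulr_gt0// ltr_wpDl.
move=> r r0; rewrite ltr_pdivlMr ?mulr_gt0 ?ltr_wpDl// => rr r1.
have r20 : 0 < r ^+ 2 by rewrite exprn_gt0.
apply: (@le_trans _ _ (\sum_i (integral_Rn (fun x => phi x * second_diff Omega r i x)
    - eps' * integral_Rn (fun x => cutoff x * second_diff_dom r i x)))).
  rewrite sumrB -mulr_sumr.
  have h1 := HC1 r r0 r1.
  have h2 : eps' * \sum_i integral_Rn (fun x => cutoff x * second_diff_dom r i x) <=
      eps' * (C * r ^+ 2) by rewrite ler_pM2l// HC.
  have h3 : eps' * C * r ^+ 2 <= eps / 2 * r ^+ 2 by rewrite ler_pM2r.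
  have h4 : C1 * r * r ^+ 2 <= eps / 2 * r ^+ 2 by rewrite ler_pM2r//; lra.
  apply: le_trans (lerB h1 h2).
  have -> : - C1 * r ^+ 3 - eps' * (C * r ^+ 2) =
    - (C1 * r * r ^+ 2) - (eps' * C * r ^+ 2) by ring.
  lra.
apply: ler_sum => i _.
have c1 : cc (fun x => phi x * second_diff Omega r i x).
  exact: ccMr cphi (@continuous_second_diff r i).
rewrite -intRZ; last exact: cc_cutoff_bound.
rewrite -intRB//; last exact/ccZ/cc_cutoff_bound.
apply: le_intR; first by apply: ccB => //; exact/ccZ/cc_cutoff_bound.
  exact: ccMr cpsi (@continuous_second_diff r i).
move=> x; suff : `|(phi x - psi x) * second_diff Omega r i x| <=
    eps' * (cutoff x * second_diff_dom r i x).
  by rewrite ler_norml => /andP[_]; rewrite mulrBl; lra.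
(* Off the [rho]-neighbourhood of [S] both [phi] and [psi] vanish; on it the cutoff is at least
   1. *)
have [h|h] := leP (dist_set x) rho; last first.
  have -> : phi x = 0.
    by apply/eqP; apply: contrapT => /negP /phiS; rewrite leNgt h.
  have -> : psi x = 0.
    by apply/eqP; apply: contrapT => /negP /psiS /dist_set_mem; have := rho0; lra.
  by rewrite subrr mul0r normr0 mulr_ge0 ?(ltW eps'0)// cutoff_second_diff_dom_ge0.
rewrite normrM; apply: ler_pM => //.
apply: (@le_trans _ _ (second_diff_dom r i x)).
  by apply: second_diff_le => //; have := dist_set_dist x; have := rho0; lra.
rewrite ler_peMl ?cutoff_ge1//; apply: le_trans (normr_ge0 _) (second_diff_le i r0 _).
by have := dist_set_dist x; have := rho0; lra.
Qed.

End Cutoff.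

(** * The weighted inequality *)

Section PowerFunctions.
Context {R : realType}.

(** The mean value theorem gives the increment as [(1 - s) c^(-s) (b - a)]; trading [c] for [a]
    costs a Lipschitz constant of [t^(-s)] times [|b - a|]. *)
Lemma powR_second_order (s rho a b : R) : 1 < s -> 0 < rho -> rho <= a -> rho <= b ->
  (b - a) * (b `^ (1 - s) - a `^ (1 - s)) <=
    - ((s - 1) * a `^ (- s)) * (b - a) ^+ 2 +
    (s - 1) * (s * rho `^ (- s - 1)) * `|b - a| ^+ 3.
Proof.
move=> s1 rho0 ra rb.
have [c [rc ca E]] : exists c, [/\ rho <= c, `|c - a| <= `|b - a| &
    b `^ (1 - s) - a `^ (1 - s) = (1 - s) * c `^ (- s) * (b - a)].
  have D t : rho <= t -> is_derive t (1 : R) (fun t : R => t `^ (1 - s)) ((1 - s) * t `^ (- s)).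
    move=> rt; have t0 : 0 < t by lra.
    by have := @is_derive1_powR R (1 - s) t t0; rewrite addrAC subrr add0r.
  have mvt x y : rho <= x -> x <= y -> exists2 c, x <= c <= y &
      y `^ (1 - s) - x `^ (1 - s) = (1 - s) * c `^ (- s) * (y - x).
    move=> rx xy.
    have Dxy t : t \in `]x, y[%R ->
        is_derive t (1 : R) (fun t : R => t `^ (1 - s)) ((1 - s) * t `^ (- s)).
      by rewrite in_itv /= => /andP[xt _]; apply: D; lra.
    have cf : {within `[x, y], continuous (fun t : R => t `^ (1 - s))}.
      apply: derivable_within_continuous => t; rewrite in_itv /= => /andP[xt _].
      by case: (D t (le_trans rx xt)).
    by have [c] := MVT_segment xy Dxy cf; rewrite in_itv /= => cxy E; exists c.
  have [ab|/ltW ba] := leP a b.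
    have [c /andP[ac cb] E] := mvt a b ra ab; exists c; split=> //; first lra.
    by rewrite !ger0_norm ?subr_ge0// lerD2r.
  have [c /andP[bc ca] E] := mvt b a rb ba; exists c; split=> //; first lra.
    by rewrite !ler0_norm ?subr_le0// !opprB lerD2l lerN2.
  by rewrite -opprB E; ring.
have L := @powR_lipschitz R (- s) rho c a _ rho0 rc ra.
have {L} : `|c `^ (- s) - a `^ (- s)| <= s * rho `^ (- s - 1) * `|b - a|.
  apply: le_trans (L _) _; first lra.
  rewrite normrN gtr0_norm; last lra.
  by rewrite ler_wpM2l// mulr_ge0 ?powR_ge0//; lra.
rewrite E; set x := c `^ _; set y := a `^ _; set K := s * _; move=> h.
set q := b - a; have q20 : 0 <= (s - 1) * q ^+ 2 by rewrite mulr_ge0 ?sqr_ge0//; lra.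
have -> : (s - 1) * K * `|q| ^+ 3 = ((s - 1) * q ^+ 2) * (K * `|q|).
  have -> : q ^+ 2 = `|q| ^+ 2 by rewrite real_normK ?num_real.
  by ring.
have -> : q * ((1 - s) * x * q) =
    - ((s - 1) * y) * q ^+ 2 + ((s - 1) * q ^+ 2) * (y - x) by ring.
rewrite lerD2l ler_wpM2l//.
by move: h; rewrite ler_norml -/q => /andP[h _]; lra.
Qed.

End PowerFunctions.

(** * Testing with the weighted absolute value of [u] and letting [r] tend to 0 *)

Section WeightedInequality.
Context {R : realType}.
Variables (n : nat) (Omega : set 'rV[R]_n) (u : 'rV[R]_n -> R) (rho Rs s : R).
Local Notation d := (dist_compl Omega).
Hypothesis nT : exists y, ~ Omega y.
Hypothesis dsuper : neg_laplacian_nonneg_distr Omega d.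
Hypothesis su : smooth u.
Hypothesis ccu : cc u.
Hypothesis u_neq0 : exists y, u y != 0.
Hypothesis rho0 : 0 < rho.
Hypothesis Sd : forall x, u x != 0 -> 4 * rho <= d x.
Hypothesis dRs : forall x, d x <= Rs.
Hypothesis s1 : 1 < s.

Let S : set 'rV[R]_n := [set x | u x != 0].

(** Truncation from below makes negative powers Lipschitz on the whole space and changes nothing on
    the support of [u]. *)
Definition dist_trunc (x : 'rV[R]_n) : R := Num.max (d x) rho.

(** Subtracting [Rs^(1-s)] keeps the weight nonnegative and produces the extra gradient term of the
    theorem. *)
Definition weight (x : 'rV[R]_n) : R := dist_trunc x `^ (1 - s) - Rs `^ (1 - s).

Lemma dist_trunc_ge (x : 'rV[R]_n) : rho <= dist_trunc x.
Proof. by rewrite le_max lexx orbT. Qed.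

Lemma dist_truncE (x : 'rV[R]_n) : rho <= d x -> dist_trunc x = d x.
Proof. by move=> h; exact/max_idPl. Qed.

Lemma dist_trunc_lip (x y : 'rV[R]_n) :
  `|dist_trunc x - dist_trunc y| <= enorm (x - y).
Proof.
have H a b : dist_trunc a - dist_trunc b <= enorm (a - b).
  have h1 := dist_compl_lip1 nT a b.
  have h2 : d b <= dist_trunc b by rewrite le_max lexx.
  have h3 := dist_trunc_ge b; have h4 := enorm_ge0 (a - b).
  suff : dist_trunc a <= enorm (a - b) + dist_trunc b by lra.
  by rewrite ge_max; apply/andP; split; lra.
have h1 := H x y; have h2 := H y x; rewrite -(enormN (y - x)) opprB in h2.
by rewrite ler_norml; apply/andP; split; lra.
Qed.

Lemma continuous_dist_trunc_powR (p : R) : p <= 1 ->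
  continuous (fun x => dist_trunc x `^ p).
Proof.
move=> p1; apply: (@lip_continuous _ _ (`|p| * rho `^ (p - 1))) => x y.
apply: le_trans (powR_lipschitz p1 rho0 (dist_trunc_ge x) (dist_trunc_ge y)) _.
by rewrite ler_wpM2l ?mulr_ge0 ?powR_ge0// dist_trunc_lip.
Qed.

Lemma rho_le_Rs : rho <= Rs.
Proof. by case: u_neq0 => y /Sd; have := dRs y; have := rho0; lra. Qed.

Lemma weight_ge0 (x : 'rV[R]_n) : 0 <= weight x.
Proof.
rewrite subr_ge0; apply: powR_antitone; first by have := s1; lra.
  exact: lt_le_trans rho0 (dist_trunc_ge x).
by rewrite ge_max dRs rho_le_Rs.
Qed.

Lemma weight_le (x : 'rV[R]_n) : weight x <= rho `^ (1 - s).
Proof.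
have : dist_trunc x `^ (1 - s) <= rho `^ (1 - s).
  apply: powR_antitone (dist_trunc_ge x) => //; have := s1; lra.
by rewrite /weight; have := powR_ge0 Rs (1 - s); lra.
Qed.

Lemma continuous_weight : continuous weight.
Proof.
apply: (@continuous_funB _ _ (fun x => dist_trunc x `^ (1 - s)) (fun=> Rs `^ (1 - s))).
  by apply: continuous_dist_trunc_powR; have := s1; lra.
exact: continuous_fun_cst.
Qed.

Lemma cc_enorm_gradient : cc (fun x => enorm (gradient u x)).
Proof.
have c1 : cc (fun x => \sum_i partial i u x * partial i u x).
  apply: cc_sum => i; have c := smooth_cc [:: i] su ccu.
  exact: (ccMr c c.1).
have -> : (fun x => enorm (gradient u x)) =
    (fun x => Num.sqrt (\sum_i partial i u x * partial i u x)).
  by apply/funext => x; congr Num.sqrt; apply: eq_bigr => i _; rewrite mxE expr2.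
apply: (cc_sub c1) => [x|x ->]; last by rewrite sqrtr0.
by apply: continuous_comp; [exact: c1.1|exact: sqrt_continuous].
Qed.

Lemma gradient_off_closure (x : 'rV[R]_n) : ~ closure S x -> enorm (gradient u x) = 0.
Proof.
move=> ncl; rewrite /enorm big1 ?sqrtr0// => i _.
by rewrite mxE partial_vanish ?expr0n//; exact: vanish_off_closure.
Qed.

(** The difference of the two sides of the claimed inequality, under the integral and with [d]
    truncated. *)
Definition weighted_deficit (x : 'rV[R]_n) : R :=
  weight x * enorm (gradient u x) - (s - 1) * dist_trunc x `^ (- s) * `|u x|.

Lemma cc_weighted_deficit : cc weighted_deficit.
Proof.
apply: ccB; first exact: ccMl continuous_weight cc_enorm_gradient.
have c1 := @continuous_dist_trunc_powR (- s).
apply: ccMl (cc_norm ccu); apply: continuous_funM; first exact: continuous_fun_cst.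
by apply: c1; have := s1; lra.
Qed.

(** Near the support of [u] this is [pointwise_estimate], with constants from bounds on [u], its
    derivatives and the weight; farther away [u] contributes nothing. The cutoff makes the error
    terms integrable. *)
Lemma pointwise_bound : exists K1 K2, [/\ 0 <= K1, 0 <= K2 &
  forall r x, 0 < r -> r <= rho ->
  \sum_i (`|u (x + r *: basis_vec R i)| * weight (x + r *: basis_vec R i)
      - `|u x| * weight x) * (d (x + r *: basis_vec R i) - d x) <=
    r ^+ 2 * weighted_deficit x + K1 * r ^+ 3 * cutoff S rho x +
    K2 * r * \sum_i cutoff S rho x * second_diff_dom Omega rho r i x].
Proof.
have [L L0 HL] := cc_family_bounded (fun i => smooth_cc [:: i] su ccu).
have [C1 C10 HC1] := cc_family_bounded (fun i => smooth_cc [:: i; i] su ccu).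
have [Cu Cu0 HCu] := cc_bounded ccu.
have s10 : 0 < s - 1 by rewrite subr_gt0.
have s0 : 0 < s by apply: lt_trans s1.
pose CG := rho `^ (1 - s); pose CA := (s - 1) * rho `^ (- s).
pose LG := (s - 1) * rho `^ (- s); pose B := (s - 1) * (s * rho `^ (- s - 1)).
have CG0 : 0 <= CG by exact: powR_ge0.
have CA0 : 0 <= CA by rewrite mulr_ge0 ?powR_ge0// ltW.
have B0 : 0 <= B by rewrite !mulr_ge0 ?powR_ge0// ltW.
pose K1 := CG * n%:R * C1 + Cu * n%:R * B + n%:R * L * LG.
exists K1, (CG * L + 2 * CA * Cu).
have LG0 : 0 <= LG := CA0.
have K10 : 0 <= K1 by rewrite /K1; apply: addr_ge0; [apply: addr_ge0|]; do 2 (apply: mulr_ge0 => //).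
have K20 : 0 <= CG * L + 2 * CA * Cu by apply: addr_ge0; [|apply: mulr_ge0 => //]; exact: mulr_ge0.
split=> // r x r0 rr.
have S0 : exists y, S y by [].
have cut0 := cutoff_ge0 S rho x.
have dom0 i : 0 <= cutoff S rho x * second_diff_dom Omega rho r i x.
  exact: cutoff_second_diff_dom_ge0.
have Sdom0 : 0 <= \sum_i cutoff S rho x * second_diff_dom Omega rho r i x.
  by apply: sumr_ge0.
have zr i : enorm (r *: basis_vec R i) = r by rewrite enorm_basis gtr0_norm.
(* Farther than [r] from [S], [u] vanishes at [x] and at all [x + r e_i], and so does its gradient
   at [x]; only nonnegative errors remain on the right. *)
have [xr|rx] := leP (dist_set S x) r; last first.
  have u0 y : ~ S y -> u y = 0 by move=> /negP/negPn/eqP.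
  have ux : u x = 0 by apply: u0 => /dist_set_mem; have := r0; lra.
  have uxz i : u (x + r *: basis_vec R i) = 0.
    apply: u0 => /(dist_set_le x); rewrite opprD addrA subrr add0r enormN zr.
    by rewrite leNgt rx.
  have -> : weighted_deficit x = 0.
    rewrite /weighted_deficit ux normr0 mulr0 subr0 gradient_off_closure ?mulr0//.
    move=> clx; have : dist_set S x <= 0.
      have cl0 : closed [set x | dist_set S x <= 0].
        apply: (@closed_comp _ _ (dist_set S) [set t | t <= 0]); last exact: closed_le.
        by move=> y _; exact: continuous_dist_set.
      have : closure S `<=` [set x | dist_set S x <= 0].
        by rewrite ((closure_id _).1 cl0); apply: closure_subset => y /dist_set_mem.
      exact.
    by have := r0; lra.
  rewrite big1 => [|i _]; last by rewrite uxz ux normr0 !mul0r subrr mul0r.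
  rewrite mulr0 add0r addr_ge0//; first by rewrite !mulr_ge0// ?exprn_ge0 ?ltW.
  by rewrite !mulr_ge0// ltW.
(* A step of length [r <= rho] from here keeps [d] above [rho], so the truncation is inactive at
   both points. *)
have dx : 3 * rho <= d x.
  by have := dist_set_dist nT S0 Sd x; lra.
have rdx : rho <= d x by have := rho0; lra.
have hz i : x + r *: basis_vec R i - x = r *: basis_vec R i by rewrite addrC addKr.
have hp i : `|d (x + r *: basis_vec R i) - d x| <= r.
  by have := dist_compl_lip nT (x + r *: basis_vec R i) x; rewrite hz zr.
have rdz i : rho <= d (x + r *: basis_vec R i).
  by have := hp i; rewrite ler_norml => /andP[? _]; have := rho0; lra.
have [e [e1 He]] := dist_compl_directions nT rho0 rdx r0.
have HE i : `|r * e ord0 i - (d (x + r *: basis_vec R i) - d x)| <=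
    second_diff_dom Omega rho r i x.
  apply: le_trans (He i _ erefl) _; rewrite /second_diff_dom /second_diff lerD2l.
  rewrite ler_wpM2r// ?mulr_ge0 ?sqr_ge0// ?addr_ge0// ?divr_ge0// ?mulr_ge0// ?ltW//.
  by rewrite ltr_nat.
have du y : differentiable u y by exact: (su [::]).
have d1u i y : differentiable (partial i u) y by exact: (su [:: i]).
have w1 i : `| `|u (x + r *: basis_vec R i)| - `|u x| | <= L * r.
  apply: le_trans (ler_dist_dist _ _) _.
  by apply: taylor1 => //; [exact: ltW|exact: HL].
have w2 i : `| `|u (x + r *: basis_vec R i)| - `|u x| | <=
    r * `|partial i u x| + C1 * r ^+ 2.
  apply: le_trans (ler_dist_dist _ _) _.
  have h := @taylor2 R n i u x r C1 du (d1u i) (ltW r0) (HC1 i).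
  move: h; set U := u _; set V := u x; set P := partial i u x => h.
  have -> : U - V = (U - V - r * P) + r * P by rewrite subrK.
  apply: le_trans (ler_normD _ _) _.
  by rewrite addrC normrM (gtr0_norm r0) lerD2l.
have g1 i : `|weight (x + r *: basis_vec R i) - weight x| <= LG * r.
  rewrite /weight opprB addrA subrK.
  have p1 : 1 - s <= 1 by have := s0; lra.
  apply: le_trans (powR_lipschitz p1 rho0 (dist_trunc_ge _) (dist_trunc_ge _)) _.
  have -> : 1 - s - 1 = - s by ring.
  rewrite -opprB normrN gtr0_norm// ler_wpM2l//.
  by rewrite (le_trans (dist_trunc_lip _ _))// hz zr.
have pg i : (d (x + r *: basis_vec R i) - d x) * (weight (x + r *: basis_vec R i) - weight x)
    <= - ((s - 1) * dist_trunc x `^ (- s)) * (d (x + r *: basis_vec R i) - d x) ^+ 2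
    + B * r ^+ 3.
  rewrite /weight opprB addrA subrK !dist_truncE//.
  apply: le_trans (powR_second_order s1 rho0 rdx (rdz i)) _.
  by rewrite lerD2l; apply: (ler_wpM2l B0); rewrite lerXn2r ?nnegrE ?hp ?(ltW r0).
have A0 : 0 <= (s - 1) * dist_trunc x `^ (- s) <= CA.
  apply/andP; split; first by rewrite mulr_ge0 ?powR_ge0 ?(ltW s10).
  apply: ler_wpM2l; first exact: ltW.
  by apply: powR_antitone (dist_trunc_ge x) => //; have := s0; lra.
have := @pointwise_estimate R n (fun i => e ord0 i)
  (fun i => d (x + r *: basis_vec R i) - d x)
  (fun i => `|u (x + r *: basis_vec R i)| - `|u x|)
  (fun i => weight (x + r *: basis_vec R i) - weight x)
  (fun i => second_diff_dom Omega rho r i x) (fun i => partial i u x)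
  r (weight x) `|u x| ((s - 1) * dist_trunc x `^ (- s)) L C1 CG Cu CA LG B
  (ltW r0) L0 C10 CA0 B0.
have e2 : \sum_i e ord0 i ^+ 2 = 1 by rewrite -enorm_sqr e1 expr1n.
have G0 : 0 <= weight x <= CG by rewrite weight_ge0 weight_le.
have u0 : 0 <= `|u x| <= Cu by rewrite normr_ge0 HCu.
move=> /(_ e2 HE hp w1 w2 G0 u0 A0 pg g1) H.
have cut1 : 1 <= cutoff S rho x by apply: cutoff_ge1 => //; exact: le_trans rr.
have -> : weighted_deficit x =
  weight x * Num.sqrt (\sum_i partial i u x ^+ 2) -
    (s - 1) * dist_trunc x `^ (- s) * `|u x|.
  rewrite /weighted_deficit; congr (_ * Num.sqrt _ - _).
  by apply: eq_bigr => i _; rewrite mxE.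
have r30 : 0 <= r ^+ 3 by rewrite exprn_ge0// ltW.
have h1 : K1 * r ^+ 3 <= K1 * r ^+ 3 * cutoff S rho x.
  by rewrite ler_peMr// mulr_ge0.
have h2 : (CG * L + 2 * CA * Cu) * r * \sum_i second_diff_dom Omega rho r i x <=
    (CG * L + 2 * CA * Cu) * r * \sum_i cutoff S rho x * second_diff_dom Omega rho r i x.
  apply: ler_wpM2l; first by apply: mulr_ge0 K20 (ltW r0).
  apply: ler_sum => i _.
  by rewrite ler_peMl//; exact: le_trans (HE i).
apply: le_trans _ (lerD (lerD (lexx _) h1) h2); apply: le_trans H.
rewrite le_eqVlt; apply/orP; left; apply/eqP; apply: eq_bigr => i _.
congr (_ * _).
by move: (weight _) (weight x) `|u _| `|u x| => a b c c'; ring.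
Qed.

(** With [I] the integral, the lower bound for the tested second differences and the integrated
    pointwise bound give [- eps * r^2 <= (I + K * r) * r^2]; divide by [r^2]. *)
Lemma weighted_deficit_ge0 : 0 <= integral_Rn weighted_deficit.
Proof.
have [K1 [K2 [K10 K20 HK]]] := pointwise_bound.
have S0 : exists y, S y by [].
have [N uN] := ccu.2.
have SN x : S x -> `|x| <= N.
  by move=> Sx; rewrite leNgt; apply/negP => /uN ux; move: Sx; rewrite /S /= ux eqxx.
have [C C0 HC] := int_cutoff_bound nT rho0 S0 SN.
have cX := cc_cutoff_set rho0 S0 SN.
have cB r i := cc_cutoff_bound nT rho0 S0 SN r i.
have IX0 : 0 <= integral_Rn (cutoff S rho) by apply: intR_ge0 => //; exact: cutoff_ge0.
pose psi x := `|u x| * weight x.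
have cpsi : cc psi by exact: ccMr (cc_norm ccu) continuous_weight.
have psi0 x : 0 <= psi x by rewrite mulr_ge0// weight_ge0.
have psiS x : psi x != 0 -> S x.
  by apply: contra_neq => ux; rewrite /psi ux normr0 mul0r.
pose K := K1 * integral_Rn (cutoff S rho) + K2 * C.
have K0 : 0 <= K by rewrite addr_ge0// mulr_ge0.
apply/ler_addgt0Pr => eps2 eps20; pose eps := eps2 / 2.
have eps0 : 0 < eps by rewrite divr_gt0.
have [r0 r00 Hr0] := int_second_diff_ge nT rho0 S0 SN Sd dsuper cpsi psi0 psiS eps0.
(* The four bounds serve, in order, superharmonicity against [psi], the mass bound, the pointwise
   bound, and [K * r <= eps]. *)
pose r := Num.min (Num.min (r0 / 2) 1) (Num.min rho (eps / (K + 1))).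
have r_gt0 : 0 < r by rewrite !lt_min !divr_gt0// ?ltr01 ?rho0//= ltr_wpDl.
have [r_r0 r_1 r_rho r_eps] : [/\ r <= r0 / 2, r <= 1, r <= rho & r <= eps / (K + 1)].
  by split; rewrite !ge_min lexx ?orbT.
have Kr : K * r <= eps.
  apply: (@le_trans _ _ ((K + 1) * r)); first by move: (r_gt0); clearbody K r; lra.
  by rewrite mulrC -ler_pdivlMr ?ltr_wpDl.
have r_r0' : r < r0 by apply: le_lt_trans r_r0 _; rewrite ltr_pdivrMr// ltr_pMr// ltr1n.
have := Hr0 r r_gt0 r_r0' r_1.
have cd : continuous d := dist_compl_continuous nT.
have cdd i : cc (fun x => (psi (x + r *: basis_vec R i) - psi x) *
    (d (x + r *: basis_vec R i) - d x)).
  have c1 := ccB (cc_shift (r *: basis_vec R i) cpsi) cpsi.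
  have c2 := continuous_funB (@continuous_shiftr R n (r *: basis_vec R i) d cd) cd.
  exact: ccMr c1 c2.
have -> : \sum_i integral_Rn (fun x => psi x * second_diff Omega r i x) =
    integral_Rn (fun x => \sum_i (psi (x + r *: basis_vec R i) - psi x) *
    (d (x + r *: basis_vec R i) - d x)).
  rewrite intR_sum//; apply: eq_bigr => i _.
  exact: (intR_second_diff (r *: basis_vec R i) cpsi cd).
have cW := cc_weighted_deficit.
have c3 : cc (fun x => \sum_i cutoff S rho x * second_diff_dom Omega rho r i x).
  by apply: cc_sum => i; exact: cB.
have upper : integral_Rn (fun x => \sum_i (psi (x + r *: basis_vec R i) - psi x) *
    (d (x + r *: basis_vec R i) - d x)) <=
    r ^+ 2 * integral_Rn weighted_deficit + K1 * r ^+ 3 * integral_Rn (cutoff S rho)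
    + K2 * r * (C * r ^+ 2).
  have h : K2 * r * \sum_i integral_Rn (fun x => cutoff S rho x *
      second_diff_dom Omega rho r i x) <= K2 * r * (C * r ^+ 2).
    by rewrite ler_wpM2l ?HC// mulr_ge0// ltW.
  apply: le_trans (lerD (lexx _) h).
  have cc12 := ccD (ccZ (r ^+ 2) cW) (ccZ (K1 * r ^+ 3) cX).
  rewrite -intR_sum => [|i]; last exact: cB.
  rewrite -(intRZ _ cW) -(intRZ _ cX) -(intRZ _ c3).
  rewrite -(intRD (ccZ _ cW) (ccZ _ cX)) -(intRD cc12 (ccZ _ c3)).
  apply: le_intR; [exact: cc_sum|exact: ccD cc12 (ccZ _ c3)|].
  by move=> x; exact: HK.
move=> lower; have := le_trans lower upper.
set I := integral_Rn weighted_deficit; set X := integral_Rn (cutoff S rho).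
have -> : r ^+ 2 * I + K1 * r ^+ 3 * X + K2 * r * (C * r ^+ 2) = (I + K * r) * r ^+ 2.
  by rewrite /K -/X; ring.
rewrite ler_pM2r ?exprn_gt0// /eps => h.
by move: Kr; rewrite /eps; lra.
Qed.

End WeightedInequality.

(** * From the truncated weight to the integrals over the domain *)

Theorem theorem2p13 (R : realType) (n : nat) (Omega : set 'rV[R]_n) :
  open Omega -> Omega <> setT ->
  neg_laplacian_nonneg_distr Omega (dist_compl Omega) ->
  has_ubound [set dist_compl Omega x | x in Omega] ->
  let Rsup := sup [set dist_compl Omega x | x in Omega] in
  forall (u : 'rV[R]_n -> R), test_fun Omega u ->
  forall s : R, 1 < s ->
  integral_over Omega
      (fun x => enorm (gradient u x) / (dist_compl Omega x) `^ (s - 1))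
  >= (s - 1) * integral_over Omega
        (fun x => `|u x| / (dist_compl Omega x) `^ s)
     + 1 / Rsup `^ (s - 1) * integral_over Omega (fun x => enorm (gradient u x)).
Proof.
move=> oO OT dsuper ub Rs u [su cpt supp] s s1.
have nT : exists y, ~ Omega y.
  by apply: contrapT => H; apply: OT; apply/seteqP; split=> // y _;
    apply: contrapT => nOy; apply: H; exists y.
have cu : continuous u by move=> x; exact/differentiable_continuous/(su [::]).
have ccu : cc u by exact: compact_support_cc.
have u_off x : ~ closure [set x | u x != 0] x -> u x = 0.
  by move=> ncl; apply/eqP; apply: contrapT => /negP ux; apply: ncl; exact: subset_closure.
have grad_off := @gradient_off_closure R n u.
(* For [u = 0] all integrals vanish; otherwise the support is nonempty, as the minimum of [d] and
   the cutoff demand. *)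
have [u0|nu0] := pselect (exists y, u y != 0); last first.
  have nocl x : ~ closure [set x | u x != 0] x.
    have -> : [set x | u x != 0] = set0.
      by apply/seteqP; split=> // y uy; apply: nu0; exists y.
    by rewrite closure0.
  have Z (f : 'rV[R]_n -> R) : (forall x, f x = 0) -> integral_over Omega f = 0.
    move=> f0; rewrite -[RHS](intR0 n); congr integral_Rn; apply/funext => x.
    by rewrite f0 if_same.
  rewrite !Z ?mulr0 ?addr0// => x; rewrite ?u_off ?grad_off ?normr0 ?mul0r//.
(* A quarter of the minimum of [d] on the compact support of [u], positive because the support lies
   in the open set [Omega]. *)
have [rho [rho0 Hcl]] : exists rho, 0 < rho /\
    forall x, closure [set x | u x != 0] x -> 4 * rho <= dist_compl Omega x.
  have ne : closure [set x | u x != 0] !=set0.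
    by case: u0 => y uy; exists y; exact: subset_closure.
  have [c ccl Hc] := EVT_min_rV ne cpt (continuous_subspaceT (dist_compl_continuous nT)).
  have dc : 0 < dist_compl Omega c.
    by apply: dist_compl_gt0 => //; apply: supp; move: ccl; rewrite inE.
  exists (dist_compl Omega c / 4); split; first by rewrite divr_gt0.
  move=> x clx; rewrite mulrC divfK ?pnatr_eq0//; apply: Hc; exact: mem_set.
have Sd x : u x != 0 -> 4 * rho <= dist_compl Omega x.
  by move=> ux; apply: Hcl; exact: subset_closure.
have dRs x : dist_compl Omega x <= Rs.
  have le_Rs y : Omega y -> dist_compl Omega y <= Rs.
    by move=> Oy; apply: sup_upper_bound; [split=> //; exists (dist_compl Omega y)|]; exists y.
  have [Ox|nOx] := pselect (Omega x); first exact: le_Rs.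
  apply: le_trans (dist_compl_out nOx) _; case: u0 => y uy.
  apply: le_trans (le_Rs y _); first exact: dist_compl_ge0.
  by apply: supp; exact: subset_closure.
have main := weighted_deficit_ge0 nT dsuper su ccu u0 rho0 Sd dRs s1.
have cE := cc_enorm_gradient su ccu.
have rcl x : closure [set x | u x != 0] x -> rho <= dist_compl Omega x.
  by move=> /Hcl; lra.
(* On the closed support of [u] the truncation is inactive; off it both integrands vanish. The next
   integral is treated likewise. *)
have E1 : integral_over Omega (fun x => enorm (gradient u x) / dist_compl Omega x `^ (s - 1)) =
    integral_Rn (fun x => dist_trunc Omega rho x `^ (1 - s) * enorm (gradient u x)).
  congr integral_Rn; apply/funext => x.
  have [clx|ncl] := pselect (closure [set x | u x != 0] x); last first.
    by rewrite grad_off// mul0r mulr0 if_same.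
  rewrite asboolT; last exact: supp.
  by rewrite dist_truncE ?rcl// mulrC -powRN opprB.
have E2 : integral_over Omega (fun x => `|u x| / dist_compl Omega x `^ s) =
    integral_Rn (fun x => dist_trunc Omega rho x `^ (- s) * `|u x|).
  congr integral_Rn; apply/funext => x.
  have [clx|ncl] := pselect (closure [set x | u x != 0] x); last first.
    by rewrite u_off// normr0 mul0r mulr0 if_same.
  rewrite asboolT; last exact: supp.
  by rewrite dist_truncE ?rcl// mulrC -powRN.
have E3 : integral_over Omega (fun x => enorm (gradient u x)) =
    integral_Rn (fun x => enorm (gradient u x)).
  congr integral_Rn; apply/funext => x; case: asboolP => // nOx.
  by rewrite grad_off// => /supp.
have c1 : cc (fun x => dist_trunc Omega rho x `^ (1 - s) * enorm (gradient u x)).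
  by apply: ccMl => //; apply: continuous_dist_trunc_powR => //; lra.
have c2 : cc (fun x => dist_trunc Omega rho x `^ (- s) * `|u x|).
  by apply: ccMl (cc_norm ccu); apply: continuous_dist_trunc_powR => //; lra.
rewrite E1 E2 E3 mul1r -powRN opprB.
move: main; rewrite /weighted_deficit /weight.
have -> : (fun x => (dist_trunc Omega rho x `^ (1 - s) - Rs `^ (1 - s)) * enorm (gradient u x)
      - (s - 1) * dist_trunc Omega rho x `^ (- s) * `|u x|) =
    (fun x => (dist_trunc Omega rho x `^ (1 - s) * enorm (gradient u x)
      - Rs `^ (1 - s) * enorm (gradient u x))
      - (s - 1) * (dist_trunc Omega rho x `^ (- s) * `|u x|)).
  by apply/funext => x; rewrite mulrBl mulrA.
rewrite intRB; [|by apply: ccB => //; exact: ccZ|exact: ccZ].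
rewrite intRB//; last exact: ccZ.
by rewrite !intRZ//; lra.
Qed.
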